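(* Let $\Omega\subseteq\mathbb{R}^2$ be a bounded, polygonal, simply connected Lipschitz domain, let $m\ge1$ and $k\ge0$ be integers, let $f\in L^2(\Omega)$ and let $\varphi\in H(\operatorname{div}^m,\Omega)$ satisfy $(-1)^m\operatorname{div}^m\varphi=f$. Let $(\sigma,\alpha)\in L^2(\Omega;\mathbb{S}(m))\times Y$ be the unique solution of $$(\sigma,\tau)_{L^2(\Omega)}+(\tau,\operatorname{sym}\operatorname{Curl}\alpha)_{L^2(\Omega)}=(\varphi,\tau)_{L^2(\Omega)}\ \ \forall\tau\in L^2(\Omega;\mathbb{S}(m)),\qquad(\sigma,\operatorname{sym}\operatorname{Curl}\beta)_{L^2(\Omega)}=0\ \ \forall\beta\in Y.$$ Let $\mathcal{T}$ be a shape-regular triangulation of $\Omega$ and set $X_h(\mathcal{T}):=P_k(\mathcal{T};\mathbb{S}(m))$ and $Y_h(\mathcal{T}):=P_{k+1}(\mathcal{T};\mathbb{X}(m-1))\cap Y$. Then there exists a unique $(\sigma_h,\alpha_h)\in X_h(\mathcal{T})\times Y_h(\mathcal{T})$ with $$(\sigma_h,\tau_h)_{L^2(\Omega)}+(\tau_h,\operatorname{sym}\operatorname{Curl}\alpha_h)_{L^2(\Omega)}=(\varphi,\tau_h)_{L^2(\Omega)}\quad\text{for all }\tau_h\in X_h(\mathcal{T}),$$ $$(\sigma_h,\operatorname{sym}\operatorname{Curl}\beta_h)_{L^2(\Omega)}=0\quad\text{for all }\beta_h\in Y_h(\mathcal{T}),$$ and it satisfies $$\|\sigma-\sigma_h\|_{L^2(\Omega)}+\|\operatorname{sym}\operatorname{Curl}(\alpha-\alpha_h)\|_{L^2(\Omega)}\le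 C\left(\min_{\tau_h\in X_h(\mathcal{T})}\|\sigma-\tau_h\|_{L^2(\Omega)}+\min_{\beta_h\in Y_h(\mathcal{T})}\|\operatorname{sym}\operatorname{Curl}(\alpha-\beta_h)\|_{L^2(\Omega)}\right)$$ with a constant $C>0$ that is independent of the mesh-size of $\mathcal{T}$.
   Context: Tensors: for $\ell\ge 1$, $\mathbb{X}(\ell):=\prod_{j=1}^{\ell}\mathbb{R}^2\cong\mathbb{R}^{2^\ell}$ denotes the $\ell$-tensors over $\mathbb{R}^2$ with components $A_{j_1,\dots,j_\ell}$, $(j_1,\dots,j_\ell)\in\{1,2\}^\ell$; $\mathbb{X}(0):=\mathbb{R}$. $\mathbb{S}(\ell)\subseteq\mathbb{X}(\ell)$ is the subspace of symmetric tensors (components invariant under all permutations of the indices), $\mathbb{S}(0)=\mathbb{R}$. The symmetric part of $A\in\mathbb{X}(\ell)$ is $(\operatorname{sym}A)_{j_1,\dots,j_\ell}:=\frac1{\ell!}\sum_{\pi}A_{j_{\pi(1)},\dots,j_{\pi(\ell)}}$, the sum running over all permutations $\pi$ of $\{1,\dots,\ell\}$. For tensors, $A:B:=\sum_{j_1,\dots,j_\ell}A_{j_1,\dots,j_\ell}B_{j_1,\dots,j_\ell}$, and $(f,g)_{L^2(\Omega)}:=\int_\Omega f:g\,dx$ with induced norm $\|\cdot\|_{L^2(\Omega)}$. $H^1(\Omega;X)$, $L^2(\Omega;X)$ denote $X$-valued functions with components in $H^1(\Omega)$, $L^2(\Omega)$. Differential operators: $(D^mv)_{j_1,\dots,j_m}:=\partial^mv/(\partial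 x_{j_1}\cdots\partial x_{j_m})$ for $v\in H^m_0(\Omega)$. For $\sigma\in H^1(\Omega;\mathbb{X}(\ell))$, $\operatorname{Curl}\sigma\in L^2(\Omega;\mathbb{X}(\ell+1))$ is defined by $(\operatorname{Curl}\sigma)_{j_1,\dots,j_\ell,1}:=-\partial\sigma_{j_1,\dots,j_\ell}/\partial x_2$ and $(\operatorname{Curl}\sigma)_{j_1,\dots,j_\ell,2}:=\partial\sigma_{j_1,\dots,j_\ell}/\partial x_1$. $H(\operatorname{div}^m,\Omega)$ is the space of all $\psi\in L^2(\Omega;\mathbb{X}(m))$ for which there is $g\in L^2(\Omega)$ with $(\psi,D^mv)_{L^2(\Omega)}=(-1)^m(g,v)_{L^2(\Omega)}$ for all $v\in H^m_0(\Omega)$; then $\operatorname{div}^m\psi:=g$. Space $Y$: let $\mathfrak{H}(\Omega,m-1):=\{v\in H^1(\Omega;\mathbb{S}(m-1)):\int_\Omega v\,dx=0\}$, $Z:=\{\beta\in\mathfrak{H}(\Omega,m-1):\operatorname{sym}\operatorname{Curl}\beta=0\}$, and $Y:=\{\gamma\in\mathfrak{H}(\Omega,m-1):(\operatorname{Curl}\beta,\operatorname{Curl}\gamma)_{L^2(\Omega)}=0\text{ for all }\beta\in Z\}$. Triangulations: a triangulation $\mathcal{T}$ of $\Omega$ is a finite set of closed triangles covering $\overline\Omega$ such that any two distinct triangles are either disjoint or share exactly one common edge or one vertex. $P_k(\mathcal{T};X)$ denotes the functions $\Omega\to X$ whose restriction to each $T\in\mathcal{T}$ has components that are polynomials of total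 degree $\le k$. *)

(* Defs.v *)
From HB Require Import structures.
From mathcomp Require Import all_boot all_order all_algebra perm.
From mathcomp Require Import all_classical all_reals all_analysis.

Set Implicit Arguments.
Unset Strict Implicit.
Unset Printing Implicit Defensive.

Import Order.TTheory GRing.Theory Num.Theory.
Import numFieldNormedType.Exports.

Local Open Scope classical_set_scope.
Local Open Scope ring_scope.

Section Tensors.
Context {R : realType}.

(* The index set {1, 2} is 'I_2: the index 1 is ord0, the index 2 is ord_max. *)
Definition tensor (l : nat) := {ffun l.-tuple 'I_2 -> R}.

Definition perm_index (l : nat) (p : 'S_l) (J : l.-tuple 'I_2) :
  l.-tuple 'I_2 := [tuple tnth J (p i) | i < l].

Definition symmetric_tensor (l : nat) (A : tensor l) : Prop :=
  forall (p : 'S_l) (J : l.-tuple 'I_2), A (perm_index p J) = A J.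

Definition symt (l : nat) (A : tensor l) : tensor l :=
  [ffun J => (l`!)%:R^-1 * \sum_(p : 'S_l) A (perm_index p J)].

Definition tdot (l : nat) (A B : tensor l) : R := \sum_J A J * B J.

End Tensors.
Arguments tensor R l : clear implicits.

Section Domains.
Context {R : realType}.
Implicit Types (Omega : set (R * R)) (x y : R * R).

Definition segment x y : set (R * R) :=
  [set z | exists2 t : R, 0 <= t <= 1 & z = (1 - t) *: x + t *: y].

Definition domain Omega : Prop :=
  [/\ open Omega, connected Omega & Omega !=set0].

Definition boundary Omega : set (R * R) := closure Omega `\` interior Omega.

Definition polygonal Omega : Prop :=
  exists s : seq ((R * R) * (R * R)),
    boundary Omega = \bigcup_(e in [set` s]) segment e.1 e.2.

(* Every loop in Omega, parametrised over [0, 1], is homotopic in Omega,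
   relative to its base point, to the constant loop. *)
Definition simply_connected Omega : Prop :=
  forall gamma : R -> R * R,
    {within `[0, 1]%classic, continuous gamma} ->
    (forall t, 0 <= t <= 1 -> Omega (gamma t)) ->
    gamma 0 = gamma 1 ->
  exists H : R * R -> R * R,
    [/\ {within `[0, 1]%classic `*` `[0, 1]%classic, continuous H},
        forall t s, 0 <= t <= 1 -> 0 <= s <= 1 -> Omega (H (t, s)),
        forall t, 0 <= t <= 1 -> H (t, 0) = gamma t /\ H (t, 1) = gamma 0 &
        forall s, 0 <= s <= 1 -> H (0, s) = gamma 0 /\ H (1, s) = gamma 0].

(* Near each boundary point, in Cartesian coordinates rotated so that
   (c, s) is the first unit vector, Omega is the strict subgraph of a Lipschitz
   function. *)
Definition lipschitz_boundary Omega : Prop :=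
  forall p, boundary Omega p ->
  exists (c s L : R) (zeta : R -> R),
    [/\ c ^+ 2 + s ^+ 2 = 1, L.-lipschitz zeta &
        \forall x \near p,
          Omega x <-> - s * x.1 + c * x.2 < zeta (c * x.1 + s * x.2)].

End Domains.

(* Functions on Omega are represented by total functions on the plane, of which
   only the restriction to Omega matters; elements of L^2 are represented by
   Borel functions and identified up to equality almost everywhere. *)
Section Sobolev.
Context {R : realType}.
Variable Omega : set (R * R).
Implicit Types (u v w g : R * R -> R) (s : seq 'I_2).

Definition leb2 :
    {measure set (measurableTypeR R * measurableTypeR R) -> \bar R} :=
  [the measure _ _ of (@lebesgue_measure R \x @lebesgue_measure R)%E].

Definition L2 u : Prop := (u \_ Omega) \in Lfun leb2 2%:E.

Definition ip u v : R := \int[leb2]_(x in Omega) (u x * v x).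

Definition basis2 (i : 'I_2) : R * R := if i == ord0 then (1, 0) else (0, 1).

Definition pderiv (i : 'I_2) u : R * R -> R := fun x => 'D_(basis2 i) u x.

Definition pderivs s u : R * R -> R := foldr pderiv u s.

Definition smooth u : Prop := forall s x, differentiable (pderivs s u) x.

Definition test_function v : Prop :=
  let supp := closure [set x | v x != 0] in
  [/\ smooth v, compact supp & supp `<=` Omega].

Definition is_wderiv s u g : Prop :=
  forall v, test_function v -> ip u (pderivs s v) = (-1) ^+ size s * ip g v.

(* A chosen L^2 representative of the weak derivative, if there is one. *)
Definition wderiv s u : R * R -> R :=
  xget (cst 0) [set g | L2 g /\ is_wderiv s u g].

Definition Hm (m : nat) u : Prop :=
  L2 u /\ forall s, (size s <= m)%N -> exists2 g, L2 g & is_wderiv s u g.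

Definition L2t (l : nat) (psi : R * R -> tensor R l) : Prop :=
  forall J, L2 (fun x => psi x J).

Definition ipt (l : nat) (psi chi : R * R -> tensor R l) : R :=
  \int[leb2]_(x in Omega) tdot (psi x) (chi x).

Definition L2norm (l : nat) (psi : R * R -> tensor R l) : R :=
  Num.sqrt (ipt psi psi).

Definition Dm (m : nat) v : R * R -> tensor R m :=
  fun x => [ffun J : m.-tuple 'I_2 => wderiv J v x].

Definition Hmnorm (m : nat) v : R :=
  Num.sqrt (\sum_(j < m.+1) L2norm (Dm j v) ^+ 2).

Definition Hm0 (m : nat) v : Prop :=
  Hm m v /\
  forall e : R, 0 < e -> exists2 w, test_function w & Hmnorm m (v \- w) < e.

Definition is_divm (m : nat) (psi : R * R -> tensor R m) g : Prop :=
  forall v, Hm0 m v -> ipt psi (Dm m v) = (-1) ^+ m * ip g v.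

Definition Hdivm (m : nat) (psi : R * R -> tensor R m) : Prop :=
  L2t psi /\ exists2 g, L2 g & is_divm psi g.

Definition divm (m : nat) (psi : R * R -> tensor R m) : R * R -> R :=
  xget (cst 0) [set g | L2 g /\ is_divm psi g].

Definition Curl (l : nat) (sigma : R * R -> tensor R l) :
    R * R -> tensor R l.+1 :=
  fun x => [ffun J : l.+1.-tuple 'I_2 =>
    let u y := sigma y [tuple tnth J (widen_ord (leqnSn l) i) | i < l] in
    if tnth J ord_max == ord0 then - wderiv [:: ord_max] u x
    else wderiv [:: ord0] u x].

Definition symCurl (l : nat) (sigma : R * R -> tensor R l) :
  R * R -> tensor R l.+1 := fun x => symt (Curl sigma x).

Definition symmetric_ae (l : nat) (psi : R * R -> tensor R l) : Prop :=
  {ae leb2, forall x, Omega x -> symmetric_tensor (psi x)}.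

Definition L2S (l : nat) : set (R * R -> tensor R l) :=
  [set psi : R * R -> tensor R l | L2t psi /\ symmetric_ae psi].

Definition frakH (l : nat) : set (R * R -> tensor R l) :=
  [set v : R * R -> tensor R l |
     [/\ forall J, Hm 1 (fun x => v x J), symmetric_ae v &
         forall J, \int[leb2]_(x in Omega) (v x J) = 0]].

Definition Zspace (l : nat) : set (R * R -> tensor R l) :=
  [set beta : R * R -> tensor R l |
    frakH beta /\ symCurl beta = cst 0 %[ae leb2 in Omega]].

Definition Yspace (l : nat) : set (R * R -> tensor R l) :=
  [set gamma : R * R -> tensor R l | frakH gamma /\
    forall beta, Zspace beta -> ipt (Curl beta) (Curl gamma) = 0].

Definition mixed_solution (l : nat) (X : set (R * R -> tensor R l.+1))
    (Y : set (R * R -> tensor R l)) (phi sigma : R * R -> tensor R l.+1)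
    (alpha : R * R -> tensor R l) : Prop :=
  [/\ X sigma, Y alpha,
      forall tau, X tau ->
        ipt sigma tau + ipt tau (symCurl alpha) = ipt phi tau &
      forall beta, Y beta -> ipt sigma (symCurl beta) = 0].

End Sobolev.
Arguments L2S {R} Omega l.
Arguments frakH {R} Omega l.
Arguments Zspace {R} Omega l.
Arguments Yspace {R} Omega l.

Section Triangulations.
Context {R : realType}.
Implicit Types (a b c x y : R * R) (T : set (R * R)) (TT : set (set (R * R))).

Definition noncollinear a b c : bool :=
  (b.1 - a.1) * (c.2 - a.2) - (b.2 - a.2) * (c.1 - a.1) != 0.

Definition tri a b c : set (R * R) :=
  [set x | exists r s t : R,
     [/\ [/\ 0 <= r, 0 <= s & 0 <= t], r + s + t = 1 &
         x = r *: a + s *: b + t *: c]].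

Definition is_triangle T : Prop :=
  exists a b c, noncollinear a b c /\ T = tri a b c.

Definition share_edge T1 T2 : Prop :=
  exists a b c d, [/\ noncollinear a b c, T1 = tri a b c,
    noncollinear a b d, T2 = tri a b d & T1 `&` T2 = segment a b].

Definition share_vertex T1 T2 : Prop :=
  exists a b c d e, [/\ noncollinear a b c, T1 = tri a b c,
    noncollinear a d e, T2 = tri a d e & T1 `&` T2 = [set a]].

Definition triangulation (Omega : set (R * R)) TT : Prop :=
  [/\ finite_set TT,
      forall T, TT T -> is_triangle T,
      \bigcup_(T in TT) T = closure Omega &
      forall T1 T2, TT T1 -> TT T2 -> T1 <> T2 ->
        [\/ T1 `&` T2 = set0, share_edge T1 T2 | share_vertex T1 T2]].

Definition euclid_dist x y : R :=
  Num.sqrt ((x.1 - y.1) ^+ 2 + (x.2 - y.2) ^+ 2).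

(* The ratio of the diameter to the inradius is at most kappa. *)
Definition shape_regular (kappa : R) TT : Prop :=
  forall T, TT T -> exists (z : R * R) (rho : R),
    [/\ 0 < rho, [set x | euclid_dist z x <= rho] `<=` T &
        forall x y, T x -> T y -> euclid_dist x y <= kappa * rho].

Definition poly2 (k : nat) (c : nat -> nat -> R) : R * R -> R :=
  fun x => \sum_(i < k.+1) \sum_(j < k.+1 | (i + j <= k)%N)
             c i j * x.1 ^+ i * x.2 ^+ j.

(* Elements of P_k(TT; X(l)) are L^2 functions, hence the identity on each
   triangle only holds almost everywhere: no value is prescribed on the edges,
   and no continuity across them is implied. *)
Definition Pk (Omega : set (R * R)) TT (k l : nat) :
    set (R * R -> tensor R l) :=
  [set u : R * R -> tensor R l | L2t Omega u /\
    forall T, TT T -> forall J, exists c : nat -> nat -> R,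
      (fun x => u x J) = poly2 k c %[ae leb2 in T `&` Omega]].

Definition Xh (Omega : set (R * R)) TT (k l : nat) :
  set (R * R -> tensor R l) :=
  Pk Omega TT k (l := l) `&` symmetric_ae Omega (l := l).

Definition Yh (Omega : set (R * R)) TT (k l : nat) :
  set (R * R -> tensor R l) :=
  Pk Omega TT k.+1 (l := l) `&` Yspace Omega l.

End Triangulations.
Arguments Pk {R} Omega TT k l.
Arguments Xh {R} Omega TT k l.
Arguments Yh {R} Omega TT k l.

Definition is_min {R : realType} (A : set R) (a : R) : Prop :=
  A a /\ lbound A a.

(* Main.v *)
Require Import Defs.
From HB Require Import structures.
From mathcomp Require Import all_boot all_order all_algebra perm.
From mathcomp Require Import all_classical all_reals all_analysis.
From mathcomp Require Import measurable_realfun ring lra.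

Set Implicit Arguments.
Unset Strict Implicit.
Unset Printing Implicit Defensive.

Import Order.TTheory GRing.Theory Num.Theory.
Import numFieldNormedType.Exports.

Local Open Scope classical_set_scope.
Local Open Scope ring_scope.

(* Only [sym Curl Y_h <= X_h] and the injectivity of [sym Curl] on [Y] matter:
   then [sigma_h = P phi - sym Curl alpha_h], where [P] is the L^2 projection onto
   [X_h] and [sym Curl alpha_h] is the projection of [phi] onto [sym Curl Y_h].
   On the continuous level [sym Curl alpha - phi] is likewise orthogonal to
   [sym Curl Y_h], so [sym Curl alpha_h] is the best approximation of
   [sym Curl alpha], and [P sigma - sigma_h] is at most
   [|sym Curl (alpha - alpha_h)|]; hence the constant 2.

   Injectivity: if [sym Curl beta = 0] with [beta] in [Y], then [beta] is in [Z], so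
   [Curl beta] is orthogonal to itself and vanishes; on a connected domain [beta]
   is constant, hence zero because its mean is.  The inclusion holds because weak
   derivatives of piecewise polynomials in [H^1] are the derivatives of the
   pieces, the triangle boundaries being null sets. *)

(** * Boxes in the plane *)

Section Plane.
Context {R : realType}.
Implicit Types (U : set (R * R)) (l r z : R * R).

(** Functions equal almost everywhere are not identified, and [wderiv] is an arbitrary choice of
    representative. Hence [ipt] is only a semi-inner product and [symCurl] is linear only almost
    everywhere. Projections and finite spans are therefore developed modulo null vectors, and the
    image of [Yh] under [symCurl] is saturated under almost everywhere equality before projecting
    onto it. On the analytic side no mollification occurs. The tests are products of rescaled flat
    functions supported in axis-parallel boxes; they approximate indicators of boxes boundedly, so
    dominated convergence turns an identity against tests into one about integrals over boxes. In
    particular a vanishing weak gradient says that the centred first moments of the function vanish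
    on each box whose closure lies in [Omega]. This forces the average to stay the same when a box
    is cut, which is local constancy. *)

Definition box l r : set (R * R) :=
  [set z | l.1 < z.1 < r.1 /\ l.2 < z.2 < r.2].

Definition cbox l r : set (R * R) :=
  [set z | l.1 <= z.1 <= r.1 /\ l.2 <= z.2 <= r.2].

Definition ratpt (q : rat * rat) : R * R := (ratr q.1, ratr q.2).

Lemma box_cbox l r : box l r `<=` cbox l r.
Proof. by move=> z [/andP[a b] /andP[c d]]; split; rewrite !ltW. Qed.

Lemma boxE l r : box l r = `]l.1, r.1[%classic `*` `]l.2, r.2[%classic.
Proof. by apply/seteqP; split=> z /=; rewrite !in_itv /=. Qed.

Lemma measurable_box l r :
  (measurable : set (set (measurableTypeR R * measurableTypeR R))) (box l r).
Proof. by rewrite boxE; apply: measurableX; exact: measurable_itv. Qed.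

Lemma leb2_box l r : l.1 < r.1 -> l.2 < r.2 ->
  leb2 (box l r) = ((r.1 - l.1) * (r.2 - l.2))%:E.
Proof.
move=> h1 h2; rewrite boxE /leb2 /= product_measure1E; [|exact: measurable_itv..].
have H (a b : R) : a < b -> lebesgue_measure `]a, b[%classic = (b - a)%:E.
  by move=> ab; rewrite lebesgue_measure_itv /= lte_fin ab.
by transitivity ((r.1 - l.1)%:E * (r.2 - l.2)%:E)%E => //; congr (_ * _)%E; exact: H.
Qed.

(** Rational corners leave only countably many boxes, as needed for measurability and for covering
    by null sets. Having the closed box inside [U] leaves room for test functions supported in
    it. *)
Lemma rat_box_nbhs U z : open U -> U z ->
  exists q, box (ratpt q.1) (ratpt q.2) z /\ cbox (ratpt q.1) (ratpt q.2) `<=` U.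
Proof.
move=> oU Uz; have /nbhs_ballP[e /= e0 eU] : nbhs z U by exact: open_nbhs_nbhs.
have [a1] := @rat_in_itvoo R (z.1 - e) z.1 ltac:(lra).
have [b1] := @rat_in_itvoo R z.1 (z.1 + e) ltac:(lra).
have [a2] := @rat_in_itvoo R (z.2 - e) z.2 ltac:(lra).
have [b2] := @rat_in_itvoo R z.2 (z.2 + e) ltac:(lra).
rewrite !in_itv /= => /andP[h1 h2] /andP[h3 h4] /andP[h5 h6] /andP[h7 h8].
exists ((a1, a2), (b1, b2)); split; first by split; apply/andP.
move=> x [/= /andP[x1 x2] /andP[x3 x4]]; apply: eU; split=> /=;
  rewrite /ball /= ltr_norml; lra.
Qed.

(** The measurable sets of the plane are those of the product sigma-algebra, so open sets have to be
    recovered as countable unions of rational boxes. *)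
Lemma open_measurable2 U : open U ->
  (measurable : set (set (measurableTypeR R * measurableTypeR R))) U.
Proof.
move=> oU.
pose F (q : (rat * rat) * (rat * rat)) : set (R * R) :=
  if `[< cbox (ratpt q.1) (ratpt q.2) `<=` U >]
  then box (ratpt q.1) (ratpt q.2) else set0.
have -> : U = \bigcup_q F q.
  apply/seteqP; split=> [z Uz|z [q _]].
    have [q [qz qU]] := rat_box_nbhs oU Uz.
    by exists q => //; rewrite /F; case: asboolP.
  by rewrite /F; case: asboolP => // h /box_cbox /h.
apply: countable_bigcupT_measurable => // q.
by rewrite /F; case: ifP => _; [exact: measurable_box|exact: measurable0].
Qed.

Lemma negligible_cover U (A : set (R * R)) : open U ->
  (forall l r, cbox l r `<=` U -> leb2.-negligible (box l r `&` A)) ->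
  leb2.-negligible (U `&` A).
Proof.
move=> oU h.
pose F (n : nat) : set (R * R) :=
  if unpickle n is Some q then
    if `[< cbox (ratpt q.1) (ratpt q.2) `<=` U >]
    then box (ratpt q.1) (ratpt q.2) `&` A else set0
  else set0.
have : leb2.-negligible (\bigcup_n F n).
  apply: negligible_bigcup => k; rewrite /F; case: unpickle => [q|].
    by case: asboolP => [/h//|_]; exact: negligible_set0.
  exact: negligible_set0.
apply: negligibleS => z [Uz Az].
have [q [qz qU]] := rat_box_nbhs oU Uz.
by exists (pickle q); [by []|rewrite /F pickleK asboolT].
Qed.

Lemma continuous_measurable2 (w : R * R -> R) : continuous w ->
  measurable_fun setT (w : measurableTypeR R * measurableTypeR R -> R).
Proof.
move=> cw; apply: (measurability _ (RGenOInfty.measurableE R)).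
move=> _ [_ [a ->] <-]; rewrite setTI; apply: open_measurable2.
by move/continuousP: cw; apply; exact: interval_open.
Qed.

Lemma bounded_subset_box U : bounded_set U -> exists M, 0 < M /\
  U `<=` box (- M, - M) (M, M).
Proof.
move=> [M [Mr h]]; exists (`|M| + 1); split; first by rewrite ltr_wpDl.
move=> z Uz; have /= := h (`|M| + 2^-1) _ z Uz.
have -> : M < `|M| + 2^-1 by rewrite ltr_pwDr ?invr_gt0// ler_norm.
move=> /(_ isT); rewrite prod_normE ge_max !ler_norml => /andP[/andP[h1 h2] /andP[h3 h4]].
by split => /=; lra.
Qed.

Lemma cbox_compact l r : compact (cbox l r).
Proof.
have -> : cbox l r = `[l.1, r.1]%classic `*` `[l.2, r.2]%classic.
  by apply/seteqP; split=> z /=; rewrite !in_itv /=.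
by apply: compact_setX; exact: segment_compact.
Qed.

Lemma continuous_bounded_on U (w : R * R -> R) : bounded_set U -> continuous w ->
  exists K, 0 < K /\ forall z, U z -> `|w z| <= K.
Proof.
move=> /bounded_subset_box[M [M0 UM]] cw.
have : compact (w @` cbox (- M, - M) (M, M)).
  apply: continuous_compact; last exact: cbox_compact.
  exact: continuous_subspaceT.
move=> /compact_bounded[K [Kr h]]; exists (`|K| + 1); split.
  by rewrite ltr_wpDl.
move=> z /UM/box_cbox zM; apply: h; last by exists z.
by rewrite ltr_pwDr// ler_norm.
Qed.

Lemma bounded_leb2 U : bounded_set U -> open U -> (leb2 U < +oo)%E.
Proof.
move=> /bounded_subset_box[M [M0 UM]] oU.
apply: (@le_lt_trans _ _ (leb2 (box (-M,-M) (M,M)))).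
  apply: le_measure => //; rewrite inE; first exact: open_measurable2.
  exact: measurable_box.
by rewrite leb2_box /= ?ltry//; lra.
Qed.

Lemma open_box l r : open (box l r).
Proof.
have -> : box l r = fst @^-1` `]l.1, r.1[%classic `&` snd @^-1` `]l.2, r.2[%classic.
  by apply/seteqP; split=> z /=; rewrite !in_itv /=.
by apply: openI; apply: open_comp => [z _|];
  [exact: cvg_fst|exact: interval_open|exact: cvg_snd|exact: interval_open].
Qed.

End Plane.

(** * Square-integrable functions *)

Section AlmostEverywhere.
Context {R : realType}.
Implicit Types P Q : R * R -> Prop.

Lemma ae_true P : (forall x, P x) -> {ae leb2, forall x, P x}.
Proof.
move=> h; exists set0; split; [exact: measurable0|exact: measure0|].
by move=> x /=; apply.
Qed.

Lemma ae_imp P Q : (forall x, P x -> Q x) ->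
  {ae leb2, forall x, P x} -> {ae leb2, forall x, Q x}.
Proof. by move=> PQ; apply: negligibleS => x nQ /PQ. Qed.

Lemma ae_and P Q : {ae leb2, forall x, P x} -> {ae leb2, forall x, Q x} ->
  {ae leb2, forall x, P x /\ Q x}.
Proof.
move=> hP hQ; have := negligibleU hP hQ; apply: negligibleS => x /= /not_andP.
by case; [left|right].
Qed.

Lemma ae_all (I : finType) (P : I -> R * R -> Prop) :
  (forall i, {ae leb2, forall x, P i x}) -> {ae leb2, forall x, forall i, P i x}.
Proof.
move=> h.
have H : forall s : seq I, {ae leb2, forall x, forall i, i \in s -> P i x}.
  elim=> [|i s ih].
    exact: ae_true.
  apply: ae_imp (ae_and (h i) ih) => x [Px hs] j; rewrite inE => /predU1P[->//|].
  exact: hs.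
by apply: ae_imp (H (enum I)) => x hx i; apply: hx; rewrite mem_enum.
Qed.

End AlmostEverywhere.

Section L2space.
Context {R : realType}.
Variable Omega : set (R * R).
Hypothesis oO : open Omega.
Hypothesis bO : bounded_set Omega.
Implicit Types u v w : R * R -> R.

Lemma measurable_Omega :
  (measurable : set (set (measurableTypeR R * measurableTypeR R))) Omega.
Proof. exact: open_measurable2. Qed.
Local Notation mO := measurable_Omega.

Lemma L2_lin a u v : L2 Omega u -> L2 Omega v -> L2 Omega (fun x => a * u x + v x).
Proof.
move=> hu hv; rewrite /L2.
have -> : (fun x => a * u x + v x) \_ Omega = a *: (u \_ Omega) + (v \_ Omega).
  apply/funext => x; rewrite !fctE /patch; case: ifP => // _.
  by rewrite scaler0 addr0.
have [_ +] := @Lfun_submod_closed _ _ R leb2 2%:E ltac:(by rewrite lee_fin; lra).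
by apply.
Qed.

Lemma measurable_fun_Omega u :
  measurable_fun Omega (u : measurableTypeR R * measurableTypeR R -> R) <->
  measurable_fun setT (u \_ Omega : measurableTypeR R * measurableTypeR R -> R).
Proof. exact: (measurable_restrictT _ mO). Qed.

Lemma L2_measurable u : L2 Omega u ->
  measurable_fun Omega (u : measurableTypeR R * measurableTypeR R -> R).
Proof.
rewrite /L2 inE => /andP[/[!inE] /= + _].
by move=> h; apply/measurable_fun_Omega.
Qed.

Lemma L2_integrableM u v : L2 Omega u -> L2 Omega v ->
  leb2.-integrable Omega (EFin \o (fun x => u x * v x)).
Proof.
move=> hu hv; have := Lfun2_mul_Lfun1 hu hv.
move/Lfun1_integrable => h; apply/integrable_mkcond; first exact: mO.
move: h; congr (_.-integrable _ _); apply/funext => x /=.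
by rewrite /patch; case: ifP => //; rewrite mulr0.
Qed.

Lemma L2_sqr u :
  measurable_fun Omega (u : measurableTypeR R * measurableTypeR R -> R) ->
  (\int[leb2]_(x in Omega) (u x ^+ 2)%:E < +oo)%E -> L2 Omega u.
Proof.
move=> mu hu; rewrite /L2 inE; apply/andP; split; rewrite inE /=.
  exact/measurable_fun_Omega.
rewrite /finite_norm unlock poweR_lty//; apply: le_lt_trans hu.
rewrite [leRHS]integral_mkcond le_eqVlt; apply/orP; left; apply/eqP.
apply: eq_integral => x _ /=; rewrite powR_mulrn// -normrX /patch.
by case: ifPn => _; rewrite ?expr0n ?normr0// ger0_norm ?sqr_ge0.
Qed.

Lemma L2_bounded u K :
  measurable_fun Omega (u : measurableTypeR R * measurableTypeR R -> R) ->
  (forall x, Omega x -> `|u x| <= K) -> L2 Omega u.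
Proof.
move=> mu hK; apply: L2_sqr => //.
apply: (@le_lt_trans _ _ (\int[leb2]_(x in Omega) cst (K ^+ 2)%:E x)%E).
  apply: ge0_le_integral => //.
  - exact: mO.
  - by move=> x _; rewrite lee_fin sqr_ge0.
  - by apply/measurable_EFinP; exact: (measurable_funX 2 mu).
  - move=> x xO; rewrite lee_fin -real_normK ?num_real//.
    by rewrite lerXn2r ?nnegrE ?normr_ge0 ?hK// (le_trans _ (hK x _)).
rewrite integral_cst; last exact: mO.
by rewrite lte_mul_pinfty// ?lee_fin ?sqr_ge0//; exact: bounded_leb2.
Qed.

Lemma L2_continuous w : continuous w -> L2 Omega w.
Proof.
move=> cw; have [K [_ hK]] := continuous_bounded_on bO cw.
apply: (L2_bounded _ hK); apply: measurable_funTS.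
exact: continuous_measurable2.
Qed.

Lemma L2_cst c : L2 Omega (cst c).
Proof. by apply: L2_continuous => x; exact: cvg_cst. Qed.

Lemma L2_integrable u : L2 Omega u -> leb2.-integrable Omega (EFin \o u).
Proof.
move=> hu; have := L2_integrableM hu (L2_cst 1).
by congr (_.-integrable _ _); apply/funext => x /=; rewrite mulr1.
Qed.

Lemma L2D u v : L2 Omega u -> L2 Omega v -> L2 Omega (fun x => u x + v x).
Proof.
move=> hu hv; have := L2_lin 1 hu hv.
by congr (L2 _ _); apply/funext => x; rewrite mul1r.
Qed.

Lemma L2Z a u : L2 Omega u -> L2 Omega (fun x => a * u x).
Proof.
move=> hu; have := L2_lin a hu (L2_cst 0).
by congr (L2 _ _); apply/funext => x; rewrite addr0.
Qed.

Lemma L2_sum (I : Type) (s : seq I) (F : I -> R * R -> R) :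
  (forall i, L2 Omega (F i)) -> L2 Omega (fun x => \sum_(i <- s) F i x).
Proof.
move=> h; elim: s => [|i s ih].
  have := L2_cst 0; congr (L2 _ _).
  by apply/funext => x; rewrite big_nil.
have := L2D (h i) ih; congr (L2 _ _).
by apply/funext => x; rewrite big_cons.
Qed.

Lemma ipC u v : ip Omega u v = ip Omega v u.
Proof. by apply: eq_Rintegral => x _; rewrite mulrC. Qed.

Lemma ip_lin a u v w : L2 Omega u -> L2 Omega v -> L2 Omega w ->
  ip Omega (fun x => a * u x + v x) w = a * ip Omega u w + ip Omega v w.
Proof.
move=> hu hv hw; rewrite /ip -RintegralZl; [|exact: mO|exact: L2_integrableM].
rewrite -RintegralD; [|exact: mO| |exact: L2_integrableM].
  by apply: eq_Rintegral => x _; rewrite mulrDl mulrA.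
have := L2_integrableM (L2Z a hu) hw.
by congr (_.-integrable _ _); apply/funext => x /=; rewrite mulrA.
Qed.

Lemma ipZ a u w : L2 Omega u -> L2 Omega w ->
  ip Omega (fun x => a * u x) w = a * ip Omega u w.
Proof.
move=> hu hw; rewrite /ip -RintegralZl; [|exact: mO|exact: L2_integrableM].
by apply: eq_Rintegral => x _; rewrite mulrA.
Qed.

Lemma ip_ge0 u : 0 <= ip Omega u u.
Proof. by apply: Rintegral_ge0 => x _; rewrite -expr2 sqr_ge0. Qed.

Lemma Rintegral_ae u v :
  measurable_fun Omega (u : measurableTypeR R * measurableTypeR R -> R) ->
  measurable_fun Omega (v : measurableTypeR R * measurableTypeR R -> R) ->
  u = v %[ae leb2 in Omega] ->
  \int[leb2]_(x in Omega) u x = \int[leb2]_(x in Omega) v x.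
Proof.
move=> hu hv uv; congr fine; apply: ae_eq_integral.
- exact: mO.
- exact/measurable_EFinP.
- exact/measurable_EFinP.
- by apply: ae_imp uv => x h /h /= ->.
Qed.

Lemma ip_ae u v w : L2 Omega u -> L2 Omega v -> L2 Omega w ->
  u = v %[ae leb2 in Omega] -> ip Omega u w = ip Omega v w.
Proof.
move=> hu hv hw uv; apply: Rintegral_ae.
- by apply: (measurable_funM (L2_measurable _) (L2_measurable _)).
- by apply: (measurable_funM (L2_measurable _) (L2_measurable _)).
- by apply: ae_imp uv => x h /h /= ->.
Qed.

Lemma ip_eq0 u : L2 Omega u -> ip Omega u u = 0 -> u = cst 0 %[ae leb2 in Omega].
Proof.
move=> hu h; have iu := L2_integrableM hu hu.
have : (\int[leb2]_(x in Omega) `|(u x * u x)%:E|)%E = 0%E.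
  transitivity (\int[leb2]_(x in Omega) (u x * u x)%:E)%E.
    by apply: eq_integral => x _; rewrite gee0_abs// lee_fin -expr2 sqr_ge0.
  by rewrite -[LHS]fineK; [congr EFin|apply: integrable_fin_num => //; exact: mO].
move/(ae_eq_integral_abs _ mO (measurable_int _ iu)).
by apply: ae_imp => x h' /h' /= [] /eqP; rewrite mulf_eq0 orbb => /eqP.
Qed.

End L2space.

(** * Smooth test functions *)

Section FlatFunctions.
Context {R : realType}.
Implicit Types (x y t : R) (k n : nat).

(* [flat 0] is the classical flat function; the family is closed under
   differentiation up to linear combinations. *)
Definition flat k t : R := if 0 < t then t ^- k * expR (- t^-1) else 0.

Lemma flat_le0 k t : t <= 0 -> flat k t = 0.
Proof. by rewrite /flat leNgt => /negbTE ->. Qed.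

Lemma flat_ge0 k t : 0 <= flat k t.
Proof.
rewrite /flat; case: ifP => // t0.
by rewrite mulr_ge0 ?expR_ge0// invr_ge0 exprn_ge0// ltW.
Qed.

(* From [exp s >= s^(j+1) / (j+1)!] with [s = 1/t]. *)
Lemma flat_le_pow k j t : 0 < t -> flat k t <= (k + j).+1`!%:R * t ^+ j.+1.
Proof.
move=> t0; rewrite /flat t0.
have h := expR_ge1Dxn (k + j) (ltW (_ : 0 < t^-1)).
have {h} := h ltac:(by rewrite invr_gt0).
set N := (k + j).+1`!; have N0 : 0 < N%:R :> R by rewrite ltr0n fact_gt0.
move=> h; have {}h : t^-1 ^+ (k + j).+1 / N%:R <= expR t^-1.
  by apply: le_trans h; rewrite lerDr.
rewrite expRN ler_pdivrMr ?expR_gt0//.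
rewrite -ler_pdivrMl ?mulr_gt0 ?exprn_gt0//; apply: le_trans h.
suff -> : (N%:R * t ^+ j.+1)^-1 / t ^+ k = t^-1 ^+ (k + j).+1 / N%:R by [].
rewrite exprVn -addnS exprD; field.
by rewrite !expf_neq0 ?gt_eqF.
Qed.

Lemma flat_le1 t : flat 0 t <= 1.
Proof.
rewrite /flat; case: ifP => // t0; rewrite expr0 invr1 mul1r expR_le1.
by rewrite oppr_le0 invr_ge0 ltW.
Qed.

(** Meant for [flat] at the origin, where the formulas on the two sides do not apply: the quadratic
    bound forces both the value and the limit of the difference quotients to be 0. *)
Lemma is_derive0_quadratic (f : R -> R) (C : R) :
  (forall t, `|f t| <= C * t ^+ 2) -> is_derive (0 : R) (1 : R) f 0.
Proof.
move=> h; have f0 : f 0 = 0.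
  by apply/eqP; rewrite -normr_le0; have := h 0; rewrite expr0n mulr0.
suff H : h^-1 *: ((f \o shift 0) (h *: 1) - f 0) @[h --> 0^'] --> (0 : R).
  by apply: DeriveDef; [apply/cvg_ex; exists 0|exact: cvg_lim].
have C0 : 0 <= C by have := le_trans (normr_ge0 _) (h 1); rewrite expr1n mulr1.
apply/cvgr0Pnorm_lt => e e0.
near=> t; rewrite /= addr0 f0 subr0 /GRing.scale /= mulr1 normrM normfV.
have t0 : 0 < `|t| by rewrite normr_gt0; near: t; exact: nbhs_dnbhs_neq.
rewrite mulrC ltr_pdivrMr//; apply: le_lt_trans (h t) _.
rewrite -real_normK ?num_real// expr2 mulrA ltr_pM2r//.
apply: (@le_lt_trans _ _ ((C + 1) * `|t|)); first by rewrite ler_pM2r// lerDl.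
rewrite mulrC -ltr_pdivlMr ?ltr_wpDl//; near: t.
by apply: dnbhs0_lt; rewrite divr_gt0// ltr_wpDl.
Unshelve. all: by end_near. Qed.

Lemma is_derive_flat k t :
  is_derive t 1 (flat k) (- k%:R * flat k.+1 t + flat k.+2 t).
Proof.
have [t0|t0|->] := ltgtP t 0.
- rewrite !flat_le0 ?ltW// mulr0 addr0.
  apply: (@near_eq_is_derive _ _ _ (cst (0 : R))).
  by near=> y; rewrite flat_le0//; apply: ltW; near: y; exact: lt_nbhsl.
(* In the variable s = 1/t the function is a power times an exponential, so the product rule and the
   chain rule suffice. *)
- apply: (@near_eq_is_derive _ _ _ ((fun s => s ^+ k * expR (- s)) \o (fun y => y^-1))).
    near=> y; rewrite /flat /= ifT ?exprVn//; near: y; exact: lt_nbhsr.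
  have h1 : is_derive t 1 (fun y : R => y^-1) (- t ^- 2).
    have := @is_deriveV R id t 1 1 (lt0r_neq0 t0) (is_derive_id _ _).
    by rewrite /GRing.scale /= mulr1.
  have h2 (s : R) : is_derive s 1 (fun s => s ^+ k * expR (- s))
      (k%:R * s ^+ k.-1 * expR (- s) - s ^+ k * expR (- s)).
    have e1 : is_derive s 1 (fun s : R => expR (- s)) (expR (- s) * -1).
      by apply: (@is_derive1_comp R expR -%R).
    have e2 : is_derive s 1 (fun s : R => s ^+ k) (k%:R * s ^+ k.-1).
      have := @is_deriveX R _ id k s 1 1 (is_derive_id _ _).
      rewrite /GRing.scale /= mulr1; congr is_derive.
      by apply/funext => y; rewrite fctE.
    have := is_deriveM e2 e1; rewrite /GRing.scale /= => H.
    by apply: is_derive_eq H _; ring.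
  apply: is_derive_eq (is_derive1_comp (h2 _) h1) _.
  rewrite /flat t0 !exprVn /=.
  clear h2; case: k => [|k] /=; rewrite !exprS; field; first by rewrite gt_eqF.
  by rewrite expf_neq0 ?gt_eqF.
- rewrite !flat_le0// mulr0 addr0.
  (* This is the constant of [flat_le_pow] for [j] equal to 1, the case of a quadratic bound. *)
  apply: (@is_derive0_quadratic _ (k + 1).+1`!%:R) => {}t.
  rewrite ger0_norm ?flat_ge0//; have [t0|t0] := ltP 0 t; first exact: flat_le_pow.
  by rewrite flat_le0// mulr_ge0 ?sqr_ge0.
Unshelve. all: by end_near. Qed.

(** This is exp s >= 1 + s >= s at s = 1/t. *)
Lemma flat1_le1 t : flat 1 t <= 1.
Proof.
rewrite /flat; case: ifP => // t0.
rewrite expr1 expRN -invfM invf_le1 ?mulr_gt0 ?expR_gt0//.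
have := expR_ge1Dx t^-1; rewrite -(ler_pM2l t0) => /(le_trans _); apply.
by rewrite mulrDr mulr1 divff ?gt_eqF// lerDr ltW.
Qed.

(** Rescaling by [n.+1] shrinks the transition layer at 0; this is how smooth functions come to
    approximate indicators. *)
Lemma flat0_cvg1 t : 0 < t -> flat 0 (n.+1%:R * t) @[n --> \oo] --> (1 : R).
Proof.
move=> t0.
have -> : (fun n => flat 0 (n.+1%:R * t)) = fun n => expR (- (harmonic n * t^-1)).
  by apply/funext => n; rewrite /flat mulr_gt0// expr0 invr1 mul1r invfM.
have H : - (harmonic n * t^-1) @[n --> \oo] --> - (0 * t^-1 : R).
  by apply: cvgN; apply: cvgMl; exact: cvg_harmonic.
rewrite mul0r oppr0 in H; rewrite -expR0.
exact: (continuous_cvg _ (@continuous_expR R 0) H).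
Qed.

Lemma flat1_cvg0 t : 0 < t -> flat 1 (n.+1%:R * t) @[n --> \oo] --> (0 : R).
Proof.
move=> t0; have H : harmonic n * t^-1 @[n --> \oo] --> (0 : R).
  by rewrite -[X in _ --> X](mul0r t^-1); apply: cvgMl; exact: cvg_harmonic.
apply: (squeeze_cvgr _ (cvg_cst 0) H); near=> n.
rewrite flat_ge0 /= /flat mulr_gt0// expr1 invfM.
rewrite ler_piMr ?mulr_ge0 ?invr_ge0 ?ltW// expR_lt1 oppr_lt0.
by rewrite mulr_gt0 ?invr_gt0.
Unshelve. all: by end_near. Qed.

(** Trades a factor [t] for one order of [flat]. With a rescaled argument it absorbs the factor
    [n.+1] that differentiation of a cut-off produces. *)
Lemma flat_succ k t : t * flat k.+1 t = flat k t.
Proof.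
rewrite /flat; case: ifP => t0; rewrite ?mulr0//.
by rewrite mulrA exprS invfM mulrA divff ?mul1r// gt_eqF.
Qed.

End FlatFunctions.

Section SmoothFunctions.
Context {R : realType}.

(* Closed under partial derivatives by construction, and rich enough to contain
   the polynomials and the test functions used below. *)
Inductive smooth_fun : (R * R -> R) -> Prop :=
| smooth_flat k a b c : smooth_fun (fun z => flat k (a + b * z.1 + c * z.2))
| smooth_cst c : smooth_fun (fun=> c)
| smooth_fst : smooth_fun fst
| smooth_snd : smooth_fun snd
| smooth_add f g : smooth_fun f -> smooth_fun g -> smooth_fun (fun z => f z + g z)
| smooth_mul f g : smooth_fun f -> smooth_fun g -> smooth_fun (fun z => f z * g z).

Lemma is_diff_fst (z : R * R) : is_diff z (fst : R * R -> R) fst.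
Proof.
have c : continuous (fst : R * R -> R) by move=> x; exact: cvg_fst.
apply: DiffDef; first exact: (@linear_differentiable _ _ _ (fst : R * R -> R)).
by rewrite (@diff_lin _ _ _ (fst : R * R -> R)).
Qed.

Lemma is_diff_snd (z : R * R) : is_diff z (snd : R * R -> R) snd.
Proof.
have c : continuous (snd : R * R -> R) by move=> x; exact: cvg_snd.
apply: DiffDef; first exact: (@linear_differentiable _ _ _ (snd : R * R -> R)).
by rewrite (@diff_lin _ _ _ (snd : R * R -> R)).
Qed.

Lemma is_diff_flat k (t : R) : is_diff t (flat k)
  (fun h => (- k%:R * flat k.+1 t + flat k.+2 t) * h).
Proof.
have [d1 d2] := is_derive_flat k t.
have d : differentiable (flat k) t by exact/derivable1_diffP.
apply: DiffDef => //; rewrite diff1E// derive1E d2.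
by apply/funext => h; rewrite /GRing.scale /= mulrC.
Qed.

(** The induction carries the total differential, from which all directional derivatives can be
    computed; keeping its coefficients in the class gives closure under [pderiv]. *)
Lemma smooth_fun_diff f : smooth_fun f -> exists g0 g1,
  [/\ smooth_fun g0, smooth_fun g1 &
      forall z, is_diff z f (fun h : R * R => g0 z * h.1 + g1 z * h.2)].
Proof.
elim=> [k a b c|c| | |{}f g _ [f0 [f1 [sf0 sf1 df]]] _ [g0 [g1 [sg0 sg1 dg]]]
  |{}f g sf [f0 [f1 [sf0 sf1 df]]] sg [g0 [g1 [sg0 sg1 dg]]]].
- pose A z : R := a + b * z.1 + c * z.2.
  pose D z := - k%:R * flat k.+1 (A z) + flat k.+2 (A z).
  have sD : smooth_fun D.
    apply: smooth_add; last exact: smooth_flat.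
    by apply: (smooth_mul (smooth_cst _)); exact: smooth_flat.
  exists (fun z => D z * b), (fun z => D z * c); split.
  + exact: (smooth_mul sD (smooth_cst _)).
  + exact: (smooth_mul sD (smooth_cst _)).
  move=> z; have dA : is_diff z A (fun h => b * h.1 + c * h.2).
    have := is_diffD (is_diffD (is_diff_cst a z) (is_diffZ b (is_diff_fst z)))
      (is_diffZ c (is_diff_snd z)) => H.
    by apply: is_diff_eq H _; apply/funext => h; rewrite !fctE add0r.
  apply: is_diff_eq (is_diff_comp dA (is_diff_flat k (A z))) _.
  by apply/funext => h /=; rewrite /D; ring.
- exists (fun=> 0), (fun=> 0); split; [exact: smooth_cst..|] => z.
  by apply: is_diff_eq (is_diff_cst c z) _; apply/funext => h /=; rewrite !mul0r addr0.
- exists (fun=> 1), (fun=> 0); split; [exact: smooth_cst..|] => z.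
  by apply: is_diff_eq (is_diff_fst z) _; apply/funext => h /=; rewrite mul0r addr0 mul1r.
- exists (fun=> 0), (fun=> 1); split; [exact: smooth_cst..|] => z.
  by apply: is_diff_eq (is_diff_snd z) _; apply/funext => h /=; rewrite mul0r add0r mul1r.
- exists (fun z => f0 z + g0 z), (fun z => f1 z + g1 z); split; [exact: smooth_add..|] => z.
  by apply: is_diff_eq (is_diffD (df z) (dg z)) _; apply/funext => h; rewrite !fctE; ring.
- exists (fun z => f z * g0 z + g z * f0 z), (fun z => f z * g1 z + g z * f1 z).
  split; [by apply: smooth_add; exact: smooth_mul..|] => z.
  apply: is_diff_eq (is_diffM (df z) (dg z)) _; apply/funext => h.
  by rewrite !fctE /GRing.scale /=; ring.
Qed.

Lemma smooth_fun_differentiable f z : smooth_fun f -> differentiable f z.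
Proof. by move=> /smooth_fun_diff[g0 [g1 [_ _ /(_ z)[]]]]. Qed.

Lemma smooth_fun_continuous f : smooth_fun f -> continuous f.
Proof.
by move=> sf z; apply: differentiable_continuous; exact: smooth_fun_differentiable.
Qed.

Lemma smooth_fun_pderiv i f : smooth_fun f -> smooth_fun (pderiv i f).
Proof.
move=> sf; have [g0 [g1 [s0 s1 d]]] := smooth_fun_diff sf.
have -> : pderiv i f = if i == ord0 then g0 else g1; last by case: ifP.
apply/funext => z; rewrite /pderiv deriveE; last exact: smooth_fun_differentiable.
have [_ ->] := d z; rewrite /basis2; case: (i == ord0) => /=; ring.
Qed.

Lemma smooth_fun_smooth f : smooth_fun f -> smooth f.
Proof.
move=> sf s z; apply: smooth_fun_differentiable.
by elim: s => //= i s; exact: smooth_fun_pderiv.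
Qed.

Lemma pderivM i f g : smooth_fun f -> smooth_fun g ->
  pderiv i (fun z => f z * g z) = fun z => f z * pderiv i g z + g z * pderiv i f z.
Proof.
move=> sf sg; apply/funext => z; rewrite /pderiv.
by rewrite (@deriveM _ _ f g)//; apply: diff_derivable; exact: smooth_fun_differentiable.
Qed.

End SmoothFunctions.

(** * Functions with vanishing integrals over boxes *)

Section NullLines.
Context {R : realType}.
Local Notation plane := (measurableTypeR R * measurableTypeR R)%type.

(** If [q] is nonzero, every vertical section is a single point; otherwise the line is a point times
    the whole axis. *)
Lemma null_line (p q e : R) : (p != 0) || (q != 0) ->
  leb2.-negligible [set z : R * R | p * z.1 + q * z.2 + e = 0].
Proof.
move=> pq; set A := (X in _.-negligible X).
have mA : measurable (A : set plane).
  have h : measurable_fun setT ((fun z => p * z.1 + q * z.2 + e) : plane -> R).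
    apply: continuous_measurable2 => z.
    by apply: cvgD; [apply: cvgD; apply: cvgMr; [exact: cvg_fst|exact: cvg_snd]|exact: cvg_cst].
  have := h measurableT [set 0] (measurable_set1 0).
  by rewrite setTI.
apply/negligibleP; first exact: mA.
have [q0|q0] := eqVneq q 0; last first.
  rewrite /leb2 /= /product_measure1 /=; apply: integral0_eq => x _ /=.
  suff -> : xsection A x = [set - (p * x + e) / q] by exact: lebesgue_measure_set1.
  apply/seteqP; split=> y /=.
    move=> /xsectionP; by rewrite /A /= => h; apply/(mulIf q0); rewrite mulfVK//; lra.
  by move=> ->; apply/xsectionP; rewrite /A /=; field.
have p0 : p != 0 by move: pq; rewrite q0 eqxx orbF.
have -> : A = [set - e / p] `*` setT.
  apply/seteqP; split=> -[x y]; rewrite /A /= q0.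
    by move=> h; split => //; apply/(mulIf p0); rewrite mulfVK//; lra.
  by move=> [-> _]; field.
rewrite /leb2 /= product_measure1E//.
by rewrite [X in (X * _)%E](_ : _ = 0%E) ?mul0e//; exact: lebesgue_measure_set1.
Qed.

End NullLines.

Section Uniqueness.
Context {R : realType}.
Local Notation plane := (measurableTypeR R * measurableTypeR R)%type.
Implicit Types (l r z : R * R).

(** Rays form a generating class stable under intersection. The whole line is added so that
    preimages of rays under one projection are products of members of [C]. *)
Let C : set (set R) := [set A | A = setT \/ exists x, A = `]x, +oo[%classic].
Let G : set (set plane) := [set A | exists A1 A2, [/\ C A1, C A2 & A = A1 `*` A2]].

Let C_measurable (A : set R) : C A -> measurable (A : set (measurableTypeR R)).
Proof.
by case=> [->|[x ->]]; [exact: measurableT|exact: measurable_itv].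
Qed.

Let measurable_planeE : (measurable : set (set plane)) = <<s G >>.
Proof.
apply/seteqP; split; last first.
  apply: smallest_sub; first exact: sigma_algebra_measurable.
  by move=> _ [A1 [A2 [h1 h2 ->]]]; apply: measurableX; exact: C_measurable.
have mfst : measurable_fun setT (fst : g_sigma_algebraType G -> measurableTypeR R).
  apply: (measurability _ (RGenOInfty.measurableE R)) => _ [_ [x ->] <-].
  apply: sub_sigma_algebra; exists `]x, +oo[%classic, setT; split.
  - by right; exists x.
  - by left.
  - by rewrite setTI; apply/seteqP; split=> z /= => [|[]].
have msnd : measurable_fun setT (snd : g_sigma_algebraType G -> measurableTypeR R).
  apply: (measurability _ (RGenOInfty.measurableE R)) => _ [_ [x ->] <-].
  apply: sub_sigma_algebra; exists setT, `]x, +oo[%classic; split.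
  - by left.
  - by right; exists x.
  - by rewrite setTI; apply/seteqP; split=> z /= => [|[]].
apply: smallest_sub; first exact: smallest_sigma_algebra.
move=> _ [] [A mA <-].
  exact: (mfst measurableT A mA).
exact: (msnd measurableT A mA).
Qed.

Let setI_closed_C : setI_closed C.
Proof.
move=> A B [->|[x ->]] [->|[y ->]]; rewrite ?setTI ?setIT.
- by left.
- by right; exists y.
- by right; exists x.
- right; exists (Num.max x y); apply/seteqP; split => z /=;
    rewrite !in_itv /= !andbT gt_max.
    by move=> [-> ->].
  by move=> /andP[].
Qed.

(** The sets over which [g] integrates to zero form a Dynkin system: complements use the zero
    integral over the plane, disjoint unions the sigma-additivity of the charge induced by [g].
    Products of members of [C] form a pi-system that generates the measurable sets. *)
Lemma integral_rays_eq0 (g : R * R -> R) :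
  leb2.-integrable setT (EFin \o g : plane -> \bar R) ->
  (forall A1 A2, C A1 -> C A2 -> (\int[leb2]_(z in A1 `*` A2) (g z)%:E = 0)%E) ->
  forall A : set plane, measurable A -> (\int[leb2]_(z in A) (g z)%:E = 0)%E.
Proof.
move=> ig h A mA.
have hT : (\int[leb2]_z (g z)%:E = 0)%E.
  have := h setT setT (or_introl erefl) (or_introl erefl).
  by rewrite setXTT.
apply: (@dynkin_induction _ _ G (fun A => (\int[leb2]_(z in A) (g z)%:E = 0)%E) measurable_planeE).
- move=> _ _ [A1 [A2 [h1 h2 ->]]] [B1 [B2 [h3 h4 ->]]].
  exists (A1 `&` B1), (A2 `&` B2); split; [exact: setI_closed_C..|].
  by rewrite setXI.
- exact: hT.
- by move=> _ [A1 [A2 [h1 h2 ->]]]; exact: h.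
- move=> S mS S0; have : (\int[leb2]_(z in S `|` ~` S) (g z)%:E = 0)%E.
    by rewrite setUv.
  have mg : measurable_fun setT (g : plane -> R).
    by apply/measurable_EFinP; exact: measurable_int ig.
  rewrite integral_setU_EFin//.
  + by rewrite S0 add0e.
  + exact: measurableC.
  + by rewrite setUv.
  + by rewrite disj_set2E; apply/eqP; exact: setICr.
- move=> F mF tF F0.
  have := @charge_semi_sigma_additive _ _ _ (induced_charge ig) F mF tF
    (bigcupT_measurable _ mF).
  rewrite /induced_charge (_ : (fun n => _) = cst 0%E); last first.
    by apply/funext => n /=; rewrite big1// => i _; exact: F0.
  by move=> H; apply/esym; apply: (cvg_unique _ _ H) => //; exact: cvg_cst.
- by rewrite -measurable_planeE.
Qed.

(** Intersecting the box with a product of rays only moves its lower left corner, so boxes sharing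
    the corner [r] are enough to determine [g]. *)
Lemma integral_boxes_eq0 l r (g : R * R -> R) :
  leb2.-integrable (box l r) (EFin \o g : plane -> \bar R) ->
  (forall l', l.1 <= l'.1 < r.1 -> l.2 <= l'.2 < r.2 ->
    (\int[leb2]_(z in box l' r) (g z)%:E = 0)%E) ->
  {ae leb2, forall z, box l r z -> g z = 0}.
Proof.
move=> ig h.
have mb := @measurable_box R l r.
have ig' : leb2.-integrable setT (EFin \o (g \_ (box l r)) : plane -> \bar R).
  move/(integrable_mkcond _ mb): ig.
  by congr (_.-integrable _ _); apply/funext => z; rewrite /patch /=; case: ifP.
have key A : measurable (A : set plane) ->
    (\int[leb2]_(z in A) ((g \_ (box l r)) z)%:E = 0)%E.
  apply: integral_rays_eq0 ig' _ A => A1 A2 h1 h2.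
  have -> : (\int[leb2]_(z in A1 `*` A2) ((g \_ (box l r)) z)%:E =
             \int[leb2]_(z in (A1 `*` A2) `&` box l r) (g z)%:E)%E.
    by rewrite [RHS]integral_mkcondr; apply: eq_integral => z _; rewrite /patch; case: ifP.
  have P (B : set R) a b : C B -> exists a', [/\ a <= a' &
    forall x, (B x /\ a < x < b) <-> a' < x < b].
    case=> [->|[y ->]]; first by exists a; split=> // x; split=> [[]|].
    exists (Num.max a y); split=> [|x]; first by rewrite le_max lexx.
    rewrite /= in_itv /= andbT gt_max; split=> [[-> /andP[-> ->]]//|].
    by move=> /andP[/andP[-> ->] ->].
  have [l1 [ll1 e1]] := P A1 l.1 r.1 h1.
  have [l2 [ll2 e2]] := P A2 l.2 r.2 h2.
  have -> : A1 `*` A2 `&` box l r = box (l1, l2) r.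
    apply/seteqP; split=> z /=.
      by move=> [[z1 z2] [z3 z4]]; split; [apply/e1|apply/e2].
    by move=> [/e1[z1 z3] /e2[z2 z4]].
  have [lr1|rl1] := ltP l1 r.1; last first.
    rewrite (_ : box _ _ = set0) ?integral_set0//.
    apply/seteqP; split=> z //= -[/andP[/= a b] _].
    by have := lt_trans a b; rewrite ltNge rl1.
  have [lr2|rl2] := ltP l2 r.2; last first.
    rewrite (_ : box _ _ = set0) ?integral_set0//.
    apply/seteqP; split=> z //= -[_ /andP[/= a b]].
    by have := lt_trans a b; rewrite ltNge rl2.
  by apply: h => /=; apply/andP.
have := @integral_ae_eq _ _ R leb2 (box l r) mb (cst 0%E) (EFin \o g) ig
  (measurable_cst _).
move=> H; have {H} : ae_eq leb2 (box l r) (EFin \o g) (cst 0%E).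
  apply: H => E Eb mE; rewrite integral0 -[RHS](key E mE).
  apply: eq_integral => z zE /=; rewrite /patch ifT//.
  by rewrite inE; apply: Eb; exact: set_mem.
by apply: ae_imp => z H /H /= [].
Qed.

End Uniqueness.

(** * Smooth approximations of the indicator of a box *)

Section Plateau.
Context {R : realType}.
Implicit Types (l r z : R * R).

(** One rescaled [flat 0] for each side: every factor vanishes beyond its side, and inside the box
    all four tend to 1. *)
Definition plateau (n : nat) l r : R * R -> R := fun z =>
  (flat 0 (n.+1%:R * (z.1 - l.1)) * flat 0 (n.+1%:R * (r.1 - z.1))) *
  (flat 0 (n.+1%:R * (z.2 - l.2)) * flat 0 (n.+1%:R * (r.2 - z.2))).

Lemma smooth_flat1 k (c : R) (a : R) : smooth_fun (fun z => flat k (c * (z.1 - a))).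
Proof.
have := smooth_flat k (- c * a) c 0; congr smooth_fun; apply/funext => z.
by congr flat; ring.
Qed.

Lemma smooth_flat1' k (c : R) (a : R) : smooth_fun (fun z => flat k (c * (a - z.1))).
Proof.
have := smooth_flat k (c * a) (- c) 0; congr smooth_fun; apply/funext => z.
by congr flat; ring.
Qed.

Lemma smooth_flat2 k (c : R) (a : R) : smooth_fun (fun z => flat k (c * (z.2 - a))).
Proof.
have := smooth_flat k (- c * a) 0 c; congr smooth_fun; apply/funext => z.
by congr flat; ring.
Qed.

Lemma smooth_flat2' k (c : R) (a : R) : smooth_fun (fun z => flat k (c * (a - z.2))).
Proof.
have := smooth_flat k (c * a) 0 (- c); congr smooth_fun; apply/funext => z.
by congr flat; ring.
Qed.

Lemma smooth_plateau n l r : smooth_fun (plateau n l r).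
Proof.
by do 2?apply: smooth_mul; [exact: smooth_flat1|exact: smooth_flat1'|
  exact: smooth_flat2|exact: smooth_flat2'].
Qed.

Lemma plateau_out n l r z : ~ box l r z -> plateau n l r z = 0.
Proof.
move=> zb; rewrite /plateau.
have [a|a] := leP z.1 l.1.
  by rewrite (flat_le0 _ (_ : _ * (z.1 - l.1) <= 0)) ?mul0r// mulr_ge0_le0// subr_le0.
have [b|b] := leP r.1 z.1.
  by rewrite (flat_le0 _ (_ : _ * (r.1 - z.1) <= 0)) ?mulr0 ?mul0r// mulr_ge0_le0// subr_le0.
have [c|c] := leP z.2 l.2.
  by rewrite (flat_le0 _ (_ : _ * (z.2 - l.2) <= 0)) ?mul0r ?mulr0// mulr_ge0_le0// subr_le0.
have [d|d] := leP r.2 z.2.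
  by rewrite (flat_le0 _ (_ : _ * (r.2 - z.2) <= 0)) ?mulr0// mulr_ge0_le0// subr_le0.
by exfalso; apply: zb; split; apply/andP.
Qed.

Lemma flat01 (t : R) : 0 <= flat 0 t <= 1.
Proof. by rewrite flat_ge0 flat_le1. Qed.

Lemma mul01 (s t : R) : 0 <= s <= 1 -> 0 <= t <= 1 -> 0 <= s * t <= 1.
Proof. by move=> /andP[a b] /andP[c d]; rewrite mulr_ge0// mulr_ile1. Qed.

Lemma plateau01 n l r z : 0 <= plateau n l r z <= 1.
Proof. by do ! apply: mul01; exact: flat01. Qed.

Lemma plateau_cvg l r z :
  plateau n l r z @[n --> \oo] --> (\1_(box l r) z : R).
Proof.
have [zb|zb] := pselect (box l r z); last first.
  rewrite indicE memNset// (_ : (fun n => _) = cst 0); first exact: cvg_cst.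
  by apply/funext => n; rewrite plateau_out.
rewrite indicE mem_set//=; move: zb => [/andP[a b] /andP[c d]].
suff : plateau n l r z @[n --> \oo] --> (1 * 1 * (1 * 1) : R) by rewrite !mulr1.
by do ! apply: cvgM; apply: flat0_cvg1; rewrite subr_gt0.
Qed.

Lemma closed_cbox l r : closed (cbox l r).
Proof.
apply: compact_closed; [exact: norm_hausdorff|exact: cbox_compact].
Qed.

Lemma smooth_fun_test (Omega : set (R * R)) l r v : smooth_fun v ->
  (forall z, ~ box l r z -> v z = 0) -> cbox l r `<=` Omega ->
  test_function Omega v.
Proof.
move=> sv vb bO; have sub : closure [set z | v z != 0] `<=` cbox l r.
  rewrite (closure_id (cbox l r)).1; last exact: closed_cbox.
  apply: closureS => z /= vz; apply: box_cbox; apply: contrapT => /vb vz0.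
  by rewrite vz0 eqxx in vz.
split; first exact: smooth_fun_smooth.
  by apply: (subclosed_compact _ (@cbox_compact _ l r)) => //; exact: closed_closure.
exact: (subset_trans sub).
Qed.

End Plateau.

(** * The fundamental lemma of the calculus of variations *)

Section Localization.
Context {R : realType}.
Variable Omega : set (R * R).
Hypothesis oO : open Omega.
Hypothesis bO : bounded_set Omega.
Local Notation plane := (measurableTypeR R * measurableTypeR R)%type.
Implicit Types (u v w g : R * R -> R) (l r z : R * R).

(** Dominated convergence with majorant K|u|, which is integrable because [Omega] is bounded and [u]
    square-integrable. *)
Lemma ip_cvg u (w_ : nat -> R * R -> R) w (K : R) : L2 Omega u -> L2 Omega w ->
  (forall n, measurable_fun Omega (w_ n : plane -> R)) ->
  (forall n z, Omega z -> `|w_ n z| <= K) ->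
  (forall z, Omega z -> w_ n z @[n --> \oo] --> w z) ->
  ip Omega u (w_ n) @[n --> \oo] --> ip Omega u w.
Proof.
move=> hu hw mw wK wcvg.
have mO := measurable_Omega oO.
have mu := L2_measurable oO hu.
apply: fine_cvg; rewrite fineK; last first.
  by apply: integrable_fin_num => //; exact: (L2_integrableM oO hu hw).
apply: (@dominated_cvg _ _ _ leb2 Omega mO (fun n z => (u z * w_ n z)%:E)
  (fun z => (u z * w z)%:E) (fun z => (K * `|u z|)%:E)).
- move=> n; apply/measurable_EFinP.
  exact: (measurable_funM mu (mw n)).
- by move=> z Oz; apply: cvg_EFin; [exact: nearW|apply: cvgMr; exact: wcvg].
- by [].
- under eq_fun do rewrite EFinM.
  apply: integrableZl => //; have := integrable_abse (L2_integrable oO bO hu).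
  by congr (_.-integrable _ _).
- move=> n z Oz; rewrite lee_fin normrM mulrC ler_wpM2r//; exact: wK.
Qed.

Lemma L2_indicM (E : set plane) w : measurable E -> continuous w ->
  L2 Omega (fun z => \1_E z * w z).
Proof.
move=> mE cw; have [K [K0 hK]] := continuous_bounded_on bO cw.
apply: (@L2_bounded _ _ oO bO _ K) => [|z Oz].
  apply: measurable_funM; first exact: measurable_indic.
  by apply: measurable_funTS; exact: continuous_measurable2.
by rewrite indicE normrM; case: (z \in _); rewrite ?normr1 ?mul1r ?hK// normr0 mul0r ltW.
Qed.

Lemma L2_indic_mul l r w : continuous w -> L2 Omega (fun z => \1_(box l r) z * w z).
Proof. exact: (L2_indicM (measurable_box l r)). Qed.

Lemma L2_indic l r : L2 Omega (\1_(box l r)).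
Proof.
have := @L2_indic_mul l r (fun=> 1) ltac:(by move=> x; exact: cvg_cst).
by congr (L2 _ _); apply/funext => z; rewrite mulr1.
Qed.

(** A smaller class of tests: support in a box reduces integration by parts to one-variable
    integrals along the sides of a rectangle. *)
Definition box_test v := smooth_fun v /\
  exists l r, (forall z, ~ box l r z -> v z = 0) /\ cbox l r `<=` Omega.

Lemma box_test_test v : box_test v -> test_function Omega v.
Proof. by move=> [sv [l [r [vb lrO]]]]; exact: smooth_fun_test sv vb lrO. Qed.

Lemma ip_indic_eq0 g l r : L2 Omega g ->
  (forall v, box_test v -> ip Omega g v = 0) ->
  cbox l r `<=` Omega -> ip Omega g (\1_(box l r)) = 0.
Proof.
move=> hg h lrO.
have := @ip_cvg g (fun n => plateau n l r) _ 1 hg (L2_indic l r).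
rewrite (_ : (fun n => ip _ _ _) = cst 0); last first.
  apply/funext => n; apply: h; split; first exact: smooth_plateau.
  by exists l, r; split => // z; exact: plateau_out.
move=> H; apply/esym; apply: (cvg_unique _ (cvg_cst _) (H _ _ _)) => //.
- move=> n; apply: measurable_funTS; apply: continuous_measurable2.
  by apply: smooth_fun_continuous; exact: smooth_plateau.
- by move=> n z _; have /andP[? ?] := plateau01 n l r z; rewrite ger0_norm.
- by move=> z _; exact: plateau_cvg.
Qed.

Lemma ip_indicE u l r : L2 Omega u -> cbox l r `<=` Omega ->
  (ip Omega u (\1_(box l r)))%:E = (\int[leb2]_(z in box l r) (u z)%:E)%E.
Proof.
move=> hu lrO; rewrite /ip /Rintegral fineK; last first.
  apply: integrable_fin_num; first exact: measurable_Omega.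
  exact: (L2_integrableM oO hu (L2_indic l r)).
rewrite -[in RHS](setIidr (subset_trans (@box_cbox _ l r) lrO)).
rewrite [RHS]integral_mkcondr; apply: eq_integral => z _.
by rewrite /patch indicE; case: ifP; rewrite ?mulr1 ?mulr0.
Qed.

Lemma integrable_box u l r : L2 Omega u -> cbox l r `<=` Omega ->
  leb2.-integrable (box l r) (EFin \o u : plane -> \bar R).
Proof.
move=> hu lrO; apply: integrableS (L2_integrable oO bO hu).
- exact: measurable_Omega.
- exact: measurable_box.
- exact: subset_trans (@box_cbox _ l r) lrO.
Qed.

(** Plateaus carry orthogonality to tests over to zero integrals on boxes. These make [g] vanish
    almost everywhere on each box, and countably many boxes cover [Omega]. *)
Lemma fundamental_lemma_variations g : L2 Omega g ->
  (forall v, box_test v -> ip Omega g v = 0) ->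
  g = cst 0 %[ae leb2 in Omega].
Proof.
move=> hg h.
have : leb2.-negligible (Omega `&` [set z | g z <> 0]).
  apply: (negligible_cover oO) => l r lrO.
  have := @integral_boxes_eq0 R l r g (integrable_box hg lrO) _.
  case=> [l' /andP[l1 r1] /andP[l2 r2]|N [mN N0 sN]].
    rewrite -ip_indicE ?ip_indic_eq0//; apply: subset_trans lrO => z.
      by move=> [/andP[a b] /andP[c d]]; split; rewrite ?b ?d andbT;
        [exact: le_trans a|exact: le_trans c].
    by move=> [/andP[a b] /andP[c d]]; split; rewrite ?b ?d andbT;
      [exact: le_trans a|exact: le_trans c].
  by exists N; split=> // z [bz gz]; apply: sN => /= /(_ bz).
by apply: negligibleS => z /= /not_implyP[].
Qed.

End Localization.

(** * Functions with vanishing weak gradient *)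

Section Edge.
Context {R : realType}.
Implicit Types (t : R) (z : R * R).

Lemma is_derive_is_diff (f : R -> R) t (d : R) : is_derive t 1 f d ->
  is_diff t f (fun h => d * h).
Proof.
move=> [d1 d2]; have df : differentiable f t by exact/derivable1_diffP.
apply: DiffDef => //; rewrite diff1E// derive1E d2.
by apply/funext => h; rewrite /GRing.scale /= mulrC.
Qed.

Lemma is_diff_pderiv (f df : R * R -> R) z i : is_diff z f df ->
  pderiv i f z = df (basis2 i).
Proof. by move=> [d1 d2]; rewrite /pderiv deriveE// d2. Qed.

Lemma pderiv_comp_fst (f : R -> R) z (d : R) : is_derive z.1 1 f d ->
  pderiv ord0 (f \o fst) z = d /\ pderiv ord_max (f \o fst) z = 0.
Proof.
move=> /is_derive_is_diff h; have H := is_diff_comp (is_diff_fst z) h.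
by rewrite !(is_diff_pderiv _ H) /= mulr1 mulr0.
Qed.

Lemma pderiv_comp_snd (f : R -> R) z (d : R) : is_derive z.2 1 f d ->
  pderiv ord_max (f \o snd) z = d /\ pderiv ord0 (f \o snd) z = 0.
Proof.
move=> /is_derive_is_diff h; have H := is_diff_comp (is_diff_snd z) h.
by rewrite !(is_diff_pderiv _ H) /= mulr1 mulr0.
Qed.

Definition hat (n : nat) (a b t : R) : R :=
  flat 0 (n.+1%:R * (t - a)) * flat 0 (n.+1%:R * (b - t)).

(** The parabola vanishes at both ends and so compensates the steep slopes of [hat] there. The
    derivatives then stay bounded in [n] and converge to the slope of the parabola, cut off to the
    interval. *)
Definition edge n a b t : R := (t - a) * (b - t) * hat n a b t.

Definition dedge n a b t : R := (a + b - 2 * t) * hat n a b t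
  + (b - t) * (flat 1 (n.+1%:R * (t - a)) * flat 0 (n.+1%:R * (b - t)))
  - (t - a) * (flat 0 (n.+1%:R * (t - a)) * flat 1 (n.+1%:R * (b - t))).

Lemma is_derive_hat n a b t : is_derive t 1 (hat n a b)
  (n.+1%:R * (flat 2 (n.+1%:R * (t - a)) * flat 0 (n.+1%:R * (b - t))
  - flat 0 (n.+1%:R * (t - a)) * flat 2 (n.+1%:R * (b - t)))).
Proof.
have h1 : is_derive t 1 (fun t => n.+1%:R * (t - a)) n.+1%:R.
  have := is_deriveZ (n.+1%:R : R) (is_deriveB (is_derive_id t 1) (is_derive_cst a t 1)).
  by move=> H; apply: is_derive_eq H _; rewrite subr0 /GRing.scale /= mulr1.
have h2 : is_derive t 1 (fun t => n.+1%:R * (b - t)) (- n.+1%:R).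
  have := is_deriveZ (n.+1%:R : R) (is_deriveB (is_derive_cst b t 1) (is_derive_id t 1)).
  by move=> H; apply: is_derive_eq H _; rewrite sub0r /GRing.scale /= mulrN1.
have := is_deriveM
  (@is_derive1_comp R _ (fun t => n.+1%:R * (t - a)) t _ _ (is_derive_flat 0 _) h1)
  (@is_derive1_comp R _ (fun t => n.+1%:R * (b - t)) t _ _ (is_derive_flat 0 _) h2).
by move=> H; apply: is_derive_eq H _; rewrite /GRing.scale /=; ring.
Qed.

Lemma is_derive_edge n a b t : is_derive t 1 (edge n a b) (dedge n a b t).
Proof.
have h1 : is_derive t 1 (fun t => (t - a) * (b - t)) (a + b - 2 * t).
  have := is_deriveM (is_deriveB (is_derive_id t 1) (is_derive_cst a t 1))
    (is_deriveB (is_derive_cst b t 1) (is_derive_id t 1)).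
  by move=> H; apply: is_derive_eq H _; rewrite !fctE /GRing.scale /=; ring.
have := is_deriveM h1 (is_derive_hat n a b t).
move=> H; apply: is_derive_eq H _; rewrite /GRing.scale /dedge /=.
(* Each factor [n.+1] comes with a distance to an endpoint, and the two together lower [flat 2] to
   [flat 1]. This is why no power of [n] survives in [dedge]. *)
have := flat_succ 1 (n.+1%:R * (t - a)); have := flat_succ 1 (n.+1%:R * (b - t)).
by move=> <- <-; ring.
Qed.

Lemma hat_out n a b t : ~~ (a < t < b) -> hat n a b t = 0.
Proof.
rewrite negb_and -!leNgt => /orP[ta|bt]; rewrite /hat.
  by rewrite (flat_le0 _ (_ : _ * (t - a) <= 0)) ?mul0r// mulr_ge0_le0// subr_le0.
by rewrite (flat_le0 _ (_ : _ * (b - t) <= 0)) ?mulr0// mulr_ge0_le0// subr_le0.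
Qed.

Lemma dedge_out n a b t : ~~ (a < t < b) -> dedge n a b t = 0.
Proof.
move=> h; rewrite /dedge hat_out// mulr0 add0r.
move: h; rewrite negb_and -!leNgt => /orP[ta|bt].
  rewrite !(fun k => @flat_le0 _ k (_ * (t - a)) _) ?mul0r ?mulr0 ?subr0//;
  by rewrite mulr_ge0_le0// subr_le0.
rewrite !(fun k => @flat_le0 _ k (_ * (b - t)) _) ?mul0r ?mulr0 ?subr0//;
by rewrite mulr_ge0_le0// subr_le0.
Qed.

Lemma hat01 n a b t : 0 <= hat n a b t <= 1.
Proof. by apply: mul01; exact: flat01. Qed.

Lemma dedge_le n a b t : `|dedge n a b t| <= `|a + b - 2 * t| + `|b - t| + `|t - a|.
Proof.
have f1 (s : R) : 0 <= flat 1 s <= 1 by rewrite flat_ge0 flat1_le1.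
have le1 (x y : R) : 0 <= y <= 1 -> `|x * y| <= `|x|.
  by move=> /andP[y0 y1]; rewrite normrM (ger0_norm y0) ler_piMr.
rewrite /dedge; apply: le_trans (ler_normB _ _) _; apply: lerD.
  apply: le_trans (ler_normD _ _) _; apply: lerD; apply: le1; first exact: hat01.
  by apply: mul01; [exact: f1|exact: flat01].
by apply: le1; apply: mul01; [exact: flat01|exact: f1].
Qed.

Lemma hat_cvg a b t : hat n a b t @[n --> \oo] --> ((a < t < b)%R%:R : R).
Proof.
have [/andP[at1 tb]|h] := boolP (a < t < b); last first.
  rewrite (_ : (fun n => _) = cst 0); first exact: cvg_cst.
  by apply/funext => n; rewrite hat_out.
suff : hat n a b t @[n --> \oo] --> (1 * 1 : R) by rewrite mulr1.
by apply: cvgM; apply: flat0_cvg1; rewrite subr_gt0.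
Qed.

Lemma dedge_cvg a b t :
  dedge n a b t @[n --> \oo] --> ((a < t < b)%R%:R * (a + b - 2 * t) : R).
Proof.
have [/andP[at1 tb]|h] := boolP (a < t < b); last first.
  rewrite mul0r (_ : (fun n => _) = cst 0); first exact: cvg_cst.
  by apply/funext => n; rewrite dedge_out.
suff : dedge n a b t @[n --> \oo] -->
    ((a + b - 2 * t) * 1 + (b - t) * (0 * 1) - (t - a) * (1 * 0) : R).
  by rewrite !(mul0r, mulr0, mulr1, addr0, subr0) mul1r.
apply: cvgB; [apply: cvgD|]; apply: cvgMr.
- by have := @hat_cvg a b t; rewrite at1 tb.
- by apply: cvgM; [apply: flat1_cvg0|apply: flat0_cvg1]; rewrite subr_gt0.
- by apply: cvgM; [apply: flat0_cvg1|apply: flat1_cvg0]; rewrite subr_gt0.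
Qed.

Lemma smooth_hat_fst n a b : smooth_fun (hat n a b \o fst).
Proof. exact: smooth_mul (smooth_flat1 _ _ _) (smooth_flat1' _ _ _). Qed.

Lemma smooth_hat_snd n a b : smooth_fun (hat n a b \o snd).
Proof. exact: smooth_mul (smooth_flat2 _ _ _) (smooth_flat2' _ _ _). Qed.

Lemma smooth_edge_fst n a b : smooth_fun (edge n a b \o fst).
Proof.
apply: smooth_mul (smooth_hat_fst _ _ _); apply: smooth_mul.
  by apply: (smooth_add (smooth_fst)); exact: smooth_cst.
have := smooth_add (smooth_cst b) (smooth_mul (smooth_cst (-1)) smooth_fst).
by congr smooth_fun; apply/funext => z; rewrite mulN1r.
Qed.

Lemma smooth_edge_snd n a b : smooth_fun (edge n a b \o snd).
Proof.
apply: smooth_mul (smooth_hat_snd _ _ _); apply: smooth_mul.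
  by apply: (smooth_add (smooth_snd)); exact: smooth_cst.
have := smooth_add (smooth_cst b) (smooth_mul (smooth_cst (-1)) smooth_snd).
by congr smooth_fun; apply/funext => z; rewrite mulN1r.
Qed.

Lemma pderiv_edge_fst n (l r : R * R) :
  pderiv ord0 (fun z => (edge n l.1 r.1 \o fst) z * (hat n l.2 r.2 \o snd) z) =
  (fun z => dedge n l.1 r.1 z.1 * hat n l.2 r.2 z.2).
Proof.
rewrite pderivM; [|exact: smooth_edge_fst|exact: smooth_hat_snd].
apply/funext => z.
rewrite (pderiv_comp_fst (is_derive_edge _ _ _ _)).1.
by rewrite (pderiv_comp_snd (is_derive_hat _ _ _ _)).2 mulr0 add0r mulrC.
Qed.

Lemma pderiv_edge_snd n (l r : R * R) :
  pderiv ord_max (fun z => (hat n l.1 r.1 \o fst) z * (edge n l.2 r.2 \o snd) z) =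
  (fun z => hat n l.1 r.1 z.1 * dedge n l.2 r.2 z.2).
Proof.
rewrite pderivM; [|exact: smooth_hat_fst|exact: smooth_edge_snd].
apply/funext => z.
rewrite (pderiv_comp_snd (is_derive_edge _ _ _ _)).1.
by rewrite (pderiv_comp_fst (is_derive_hat _ _ _ _)).2 mulr0 addr0.
Qed.

End Edge.

(** * Vanishing weak gradient on a connected open set *)

Section LocallyConstant.
Context {R : realType}.
Variable Omega : set (R * R).
Hypothesis oO : open Omega.
Hypothesis bO : bounded_set Omega.
Variable u : R * R -> R.
Hypothesis L2u : L2 Omega u.
Hypothesis du : forall i v, test_function Omega v -> ip Omega u (pderiv i v) = 0.
Local Notation plane := (measurableTypeR R * measurableTypeR R)%type.
Implicit Types (l r z : R * R).

Lemma indic_boxE l r z : \1_(box l r) z =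
  (l.1 < z.1 < r.1)%R%:R * (l.2 < z.2 < r.2)%R%:R :> R.
Proof.
rewrite indicE; have [zb|zb] := boolP (z \in box l r).
  by move: zb => /set_mem[-> ->]; rewrite mulr1.
case: (boolP (l.1 < z.1 < r.1)) => h1; rewrite ?mul0r//.
case: (boolP (l.2 < z.2 < r.2)) => h2; rewrite ?mulr0//.
by move: zb; rewrite notin_setE => -[]; split.
Qed.

(** The test is [edge] in the first variable times [hat] in the second. As the layers shrink, its
    derivative tends boundedly to the weight of the first moment about the midline of the box. *)
Lemma moment_fst l r : cbox l r `<=` Omega ->
  ip Omega u (fun z => \1_(box l r) z * (l.1 + r.1 - 2 * z.1)) = 0.
Proof.
move=> lrO.
have cw : continuous (fun z : R * R => l.1 + r.1 - 2 * z.1).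
  move=> z; apply: cvgB; [exact: cvg_cst|apply: cvgMr; exact: cvg_fst].
pose w_ n z := dedge n l.1 r.1 z.1 * hat n l.2 r.2 z.2.
have wE n : w_ n = pderiv ord0
    (fun z => (edge n l.1 r.1 \o fst) z * (hat n l.2 r.2 \o snd) z).
  by rewrite pderiv_edge_fst.
have sw n : smooth_fun (fun z => (edge n l.1 r.1 \o fst) z * (hat n l.2 r.2 \o snd) z).
  exact: smooth_mul (smooth_edge_fst _ _ _) (smooth_hat_snd _ _ _).
pose B z := `|l.1 + r.1 - 2 * z.1| + `|r.1 - z.1| + `|z.1 - l.1|.
have cB : continuous B.
  move=> z; apply: cvgD; [apply: cvgD|].
  - by apply: cvg_norm; exact: cw.
  - by apply: cvg_norm; apply: cvgB; [exact: cvg_cst|exact: cvg_fst].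
  - by apply: cvg_norm; apply: cvgB; [exact: cvg_fst|exact: cvg_cst].
have [K [K0 hK]] := continuous_bounded_on bO cB.
have := @ip_cvg R Omega oO bO u w_ _ K L2u (L2_indic_mul oO bO l r cw).
rewrite (_ : (fun n => ip _ _ _) = cst 0); last first.
  apply/funext => n; rewrite wE; apply: du.
  apply: (smooth_fun_test (sw n) _ lrO) => z zb /=; rewrite /edge.
  have [h1|/hat_out ->] := boolP (l.1 < z.1 < r.1); last by rewrite mulr0 mul0r.
  have [h2|/hat_out ->] := boolP (l.2 < z.2 < r.2); last by rewrite mulr0.
  by exfalso; apply: zb.
move=> H; apply/esym; apply: (cvg_unique _ (cvg_cst _) (H _ _ _)) => //.
- move=> n; apply: measurable_funTS; apply: continuous_measurable2.
  by rewrite wE; apply: smooth_fun_continuous; exact: smooth_fun_pderiv.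
- move=> n z Oz; apply: le_trans (hK z Oz); apply: le_trans (ler_norm _).
  apply: le_trans (dedge_le n _ _ _); rewrite /w_ normrM.
  have /andP[h0 h1] := hat01 n l.2 r.2 z.2.
  by rewrite (ger0_norm h0) ler_piMr.
- move=> z _; rewrite indic_boxE mulrAC.
  by apply: cvgM; [exact: dedge_cvg|exact: hat_cvg].
Qed.

Lemma moment_snd l r : cbox l r `<=` Omega ->
  ip Omega u (fun z => \1_(box l r) z * (l.2 + r.2 - 2 * z.2)) = 0.
Proof.
move=> lrO.
have cw : continuous (fun z : R * R => l.2 + r.2 - 2 * z.2).
  move=> z; apply: cvgB; [exact: cvg_cst|apply: cvgMr; exact: cvg_snd].
pose w_ n z := hat n l.1 r.1 z.1 * dedge n l.2 r.2 z.2.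
have wE n : w_ n = pderiv ord_max
    (fun z => (hat n l.1 r.1 \o fst) z * (edge n l.2 r.2 \o snd) z).
  by rewrite pderiv_edge_snd.
have sw n : smooth_fun (fun z => (hat n l.1 r.1 \o fst) z * (edge n l.2 r.2 \o snd) z).
  exact: smooth_mul (smooth_hat_fst _ _ _) (smooth_edge_snd _ _ _).
pose B z := `|l.2 + r.2 - 2 * z.2| + `|r.2 - z.2| + `|z.2 - l.2|.
have cB : continuous B.
  move=> z; apply: cvgD; [apply: cvgD|].
  - by apply: cvg_norm; exact: cw.
  - by apply: cvg_norm; apply: cvgB; [exact: cvg_cst|exact: cvg_snd].
  - by apply: cvg_norm; apply: cvgB; [exact: cvg_snd|exact: cvg_cst].
have [K [K0 hK]] := continuous_bounded_on bO cB.
have := @ip_cvg R Omega oO bO u w_ _ K L2u (L2_indic_mul oO bO l r cw).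
rewrite (_ : (fun n => ip _ _ _) = cst 0); last first.
  apply/funext => n; rewrite wE; apply: du.
  apply: (smooth_fun_test (sw n) _ lrO) => z zb /=; rewrite /edge.
  have [h1|/hat_out ->] := boolP (l.1 < z.1 < r.1); last by rewrite mul0r.
  have [h2|/hat_out ->] := boolP (l.2 < z.2 < r.2); last by rewrite !mulr0.
  by exfalso; apply: zb.
move=> H; apply/esym; apply: (cvg_unique _ (cvg_cst _) (H _ _ _)) => //.
- move=> n; apply: measurable_funTS; apply: continuous_measurable2.
  by rewrite wE; apply: smooth_fun_continuous; exact: smooth_fun_pderiv.
- move=> n z Oz; apply: le_trans (hK z Oz); apply: le_trans (ler_norm _).
  apply: le_trans (dedge_le n _ _ _); rewrite /w_ normrM.
  have /andP[h0 h1] := hat01 n l.1 r.1 z.1.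
  by rewrite (ger0_norm h0) ler_piMl.
- move=> z _; rewrite indic_boxE -mulrA.
  by apply: cvgM; [exact: hat_cvg|exact: dedge_cvg].
Qed.

Let M l r := ip Omega u (\1_(box l r)).

Lemma ip_indic_affine l r (w : R * R -> R) (c : R) : continuous w ->
  ip Omega u (fun z => \1_(box l r) z * (c - 2 * w z)) =
  c * M l r - 2 * ip Omega u (fun z => \1_(box l r) z * w z).
Proof.
move=> cw; have h1 := L2_indic oO bO l r; have h2 := L2_indic_mul oO bO l r cw.
rewrite ![ip _ u _]ipC /M (ipC _ u).
have -> : (fun z => \1_(box l r) z * (c - 2 * w z)) =
    (fun z => c * \1_(box l r) z + -2 * (\1_(box l r) z * w z)).
  by apply/funext => z; ring.
rewrite (ip_lin oO bO c h1 (L2Z oO bO (-2) h2) L2u).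
by rewrite (ipZ oO (-2) h2 L2u) mulNr.
Qed.

(** Cutting an open box loses the points on the cut; additivity of the indicators is therefore asked
    only off a line, which is null. *)
Lemma ip_split (p q e : R) (b b1 b2 : (R * R) * (R * R)) (w : R * R -> R) :
  (p != 0) || (q != 0) -> continuous w ->
  (forall z, p * z.1 + q * z.2 + e != 0 ->
    \1_(box b.1 b.2) z = \1_(box b1.1 b1.2) z + \1_(box b2.1 b2.2) z :> R) ->
  ip Omega u (fun z => \1_(box b.1 b.2) z * w z) =
  ip Omega u (fun z => \1_(box b1.1 b1.2) z * w z) +
  ip Omega u (fun z => \1_(box b2.1 b2.2) z * w z).
Proof.
move=> pq cw h; rewrite ![ip _ u _]ipC.
have L l r := L2_indic_mul oO bO l r cw.
rewrite -[X in X + _]mul1r -(ip_lin oO bO 1 (L _ _) (L _ _) L2u).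
apply: (ip_ae oO _ _ L2u); [exact: L|by apply: L2_lin; exact: L|].
have := null_line e pq; apply: negligibleS => z /= /not_implyP[_ nz] /=.
by apply: contrapT => /eqP /h H; apply: nz; rewrite H; ring.
Qed.

Let cfst : continuous (fst : R * R -> R). Proof. by move=> z; exact: cvg_fst. Qed.
Let csnd : continuous (snd : R * R -> R). Proof. by move=> z; exact: cvg_snd. Qed.
Let M1 l r : M l r = ip Omega u (fun z => \1_(box l r) z * 1).
Proof. by congr ip; apply/funext => z; rewrite mulr1. Qed.

Let split_fst l r a (w : R * R -> R) : continuous w -> l.1 < a < r.1 ->
  ip Omega u (fun z => \1_(box l r) z * w z) =
  ip Omega u (fun z => \1_(box l (a, r.2)) z * w z) +
  ip Omega u (fun z => \1_(box (a, l.2) r) z * w z).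
Proof.
move=> cw /andP[la ar].
apply: (@ip_split 1 0 (- a) (l, r) (l, (a, r.2)) ((a, l.2), r)) => //.
  by rewrite oner_eq0.
move=> z /=; rewrite mul1r mul0r addr0 subr_eq0 => za; rewrite !indic_boxE /= -mulrDl.
congr (_ * _); have [h|h] := ltP z.1 a.
  by rewrite (lt_trans h ar) [a < _]ltNge (ltW h) /= addr0.
have {}h : a < z.1 by rewrite lt_neqAle eq_sym za.
by rewrite h (lt_trans la h) andbF add0r.
Qed.

Let split_snd l r a (w : R * R -> R) : continuous w -> l.2 < a < r.2 ->
  ip Omega u (fun z => \1_(box l r) z * w z) =
  ip Omega u (fun z => \1_(box l (r.1, a)) z * w z) +
  ip Omega u (fun z => \1_(box (l.1, a) r) z * w z).
Proof.
move=> cw /andP[la ar].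
apply: (@ip_split 0 1 (- a) (l, r) (l, (r.1, a)) ((l.1, a), r)) => //.
  by rewrite oner_eq0 orbT.
move=> z /=; rewrite mul1r mul0r add0r subr_eq0 => za; rewrite !indic_boxE /= -mulrDr.
congr (_ * _); have [h|h] := ltP z.2 a.
  by rewrite (lt_trans h ar) [a < _]ltNge (ltW h) /= addr0.
have {}h : a < z.2 by rewrite lt_neqAle eq_sym za.
by rewrite h (lt_trans la h) andbF add0r.
Qed.

(* With [F] the integrals and [N] the first moments over adjacent intervals,
   additivity of both turns [2 N = (a + b) F] into equality of averages. *)
Let avg (L a r F F1 F2 N N1 N2 : R) :
  F = F1 + F2 -> N = N1 + N2 -> (L + r) * F = 2 * N -> (L + a) * F1 = 2 * N1 ->
  (a + r) * F2 = 2 * N2 -> F2 * (r - L) = F * (r - a).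
Proof. by move=> -> -> h h1 h2; lra. Qed.

(** A vertical cut preserves the average of [u]: the moment identities of the box and of its two
    pieces are combined by [avg]. *)
Let avg_fst l r a : cbox l r `<=` Omega -> l.1 <= a < r.1 ->
  M (a, l.2) r * (r.1 - l.1) = M l r * (r.1 - a).
Proof.
move=> lrO /andP[]; rewrite le_eqVlt => /predU1P[<- _|la ar].
  by rewrite -surjective_pairing.
have sub1 : cbox l (a, r.2) `<=` Omega.
  apply: subset_trans lrO => z [/andP[/= h1 h2] h3]; split => //.
  by rewrite h1 (le_trans h2)// ltW.
have sub2 : cbox (a, l.2) r `<=` Omega.
  apply: subset_trans lrO => z [/andP[/= h1 h2] h3]; split => //.
  by rewrite h2 (le_trans _ h1)// ltW.
have := moment_fst lrO; have := moment_fst sub1; have := moment_fst sub2.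
rewrite !ip_indic_affine//= => /subr0_eq h2 /subr0_eq h1 /subr0_eq h.
apply: avg (split_fst cfst _) h h1 h2; rewrite ?la ?ar//.
rewrite !M1; apply: split_fst; last by rewrite la.
by move=> z; exact: cvg_cst.
Qed.

Let avg_snd l r a : cbox l r `<=` Omega -> l.2 <= a < r.2 ->
  M (l.1, a) r * (r.2 - l.2) = M l r * (r.2 - a).
Proof.
move=> lrO /andP[]; rewrite le_eqVlt => /predU1P[<- _|la ar].
  by rewrite -surjective_pairing.
have sub1 : cbox l (r.1, a) `<=` Omega.
  apply: subset_trans lrO => z [h3 /andP[/= h1 h2]]; split => //.
  by rewrite h1 (le_trans h2)// ltW.
have sub2 : cbox (l.1, a) r `<=` Omega.
  apply: subset_trans lrO => z [h3 /andP[/= h1 h2]]; split => //.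
  by rewrite h2 (le_trans _ h1)// ltW.
have := moment_snd lrO; have := moment_snd sub1; have := moment_snd sub2.
rewrite !ip_indic_affine//= => /subr0_eq h2 /subr0_eq h1 /subr0_eq h.
apply: avg (split_snd csnd _) h h1 h2; rewrite ?la ?ar//.
rewrite !M1; apply: split_snd; last by rewrite la.
by move=> z; exact: cvg_cst.
Qed.

(** Cutting in the first and then in the second variable shows that the integral of [u] over a
    sub-box with corner [r] is proportional to its area. Subtracting the average [K] makes all these
    integrals vanish. *)
Lemma const_on_box l r : cbox l r `<=` Omega -> l.1 < r.1 -> l.2 < r.2 ->
  exists K, {ae leb2, forall z, box l r z -> u z = K}.
Proof.
move=> lrO h1 h2.
have a0 : (r.1 - l.1) * (r.2 - l.2) != 0 by rewrite mulf_neq0// gt_eqF// subr_gt0.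
pose K := M l r / ((r.1 - l.1) * (r.2 - l.2)); exists K.
have L2c : L2 Omega (fun z => u z - K) by apply: L2D => //; exact: L2_cst.
suff : {ae leb2, forall z, box l r z -> u z - K = 0}.
  by apply: ae_imp => z H /H /subr0_eq.
apply: integral_boxes_eq0; first exact: (integrable_box oO bO L2c lrO).
move=> l' l1 l2.
have sub1 : cbox (l'.1, l.2) r `<=` Omega.
  apply: subset_trans lrO => z [/andP[/= h3 h4] h5]; split => //.
  by rewrite h4 (le_trans _ h3)//; case/andP: l1.
have sub2 : cbox l' r `<=` Omega.
  apply: subset_trans sub1 => z [h3 /andP[/= h4 h5]]; split => //=.
  by rewrite h5 (le_trans _ h4)//; case/andP: l2.
rewrite -(ip_indicE oO bO L2c sub2); congr EFin.
have hi := L2_indic oO bO l' r.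
have -> : ip Omega (fun z => u z - K) (\1_(box l' r)) =
    M l' r - K * ((r.1 - l'.1) * (r.2 - l'.2)).
  have := ip_lin oO bO 1 L2u (L2_cst oO bO (- K)) hi.
  under [X in ip _ X _]eq_fun do rewrite mul1r.
  move=> ->; rewrite mul1r; congr (_ + _).
  have e1 : ip Omega (cst 1) (\1_(box l' r)) = (r.1 - l'.1) * (r.2 - l'.2).
    apply/eqP; rewrite -eqe; apply/eqP.
    rewrite (ip_indicE oO bO (L2_cst oO bO 1) sub2).
    transitivity (\int[leb2]_(z in box l' r) (cst 1%E z))%E; first exact: eq_integral.
    rewrite integral_cst; last exact: measurable_box.
    by rewrite mul1e; apply: leb2_box; [case/andP: l1|case/andP: l2].
  have := ipZ oO (- K) (L2_cst oO bO 1) hi; rewrite e1 mulNr => <-.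
  by congr ip; apply/funext => z; rewrite mulr1.
have e1 := avg_fst lrO l1; have e2 := avg_snd sub1 l2.
rewrite /= -surjective_pairing in e2.
apply: (mulIf a0); rewrite mul0r mulrBl /K.
have -> : M l r / ((r.1 - l.1) * (r.2 - l.2)) * ((r.1 - l'.1) * (r.2 - l'.2)) *
  ((r.1 - l.1) * (r.2 - l.2)) = M l r * (r.1 - l'.1) * (r.2 - l'.2).
  by field; move: a0; rewrite mulf_eq0 negb_or => /andP[-> ->].
by rewrite -e1 mulrA [M l' r * _ * _]mulrAC e2; ring.
Qed.

(* The values taken on boxes around the points of [Omega] partition it into
   open sets. *)
Lemma const_of_connected : connected Omega -> Omega !=set0 ->
  exists K, u = cst K %[ae leb2 in Omega].
Proof.
move=> cO [z0 Oz0].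
pose B K := [set z | exists l r, [/\ box l r z, cbox l r `<=` Omega &
  {ae leb2, forall z, box l r z -> u z = K}]].
have BO K : B K `<=` Omega.
  by move=> z [l [r [/box_cbox bz h _]]]; exact: h.
have exB z : Omega z -> exists K, B K z.
  move=> Oz; have [q [qz qO]] := rat_box_nbhs oO Oz.
  have [K hK] := const_on_box qO ltac:(by case: qz => /andP[a b] _; exact: lt_trans b)
    ltac:(by case: qz => _ /andP[a b]; exact: lt_trans b).
  by exists K, (ratpt q.1), (ratpt q.2).
have oB K : open (B K).
  rewrite openE => z [l [r [bz h1 h2]]].
  apply: (@filterS _ _ _ (box l r)) => [x bx|]; first by exists l, r.
  apply: open_nbhs_nbhs; split => //; exact: open_box.
(* Two distinct values would make the overlap of the two boxes null, although it is a nonempty open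
   box of positive area. *)
have uB K K' z : B K z -> B K' z -> K = K'.
  move=> [l [r [bz h1 h2]]] [l' [r' [bz' h1' h2']]]; apply: contrapT => KK'.
  pose L := (Num.max l.1 l'.1, Num.max l.2 l'.2).
  pose S := (Num.min r.1 r'.1, Num.min r.2 r'.2).
  have LSz : box L S z.
    move: bz bz' => [/andP[? ?] /andP[? ?]] [/andP[? ?] /andP[? ?]].
    by split; rewrite /= gt_max lt_min; apply/andP; split; apply/andP.
  have H : leb2.-negligible (box L S).
    have := ae_and h2 h2'; apply: negligibleS => x [/=].
    rewrite !gt_max !lt_min => /andP[/andP[? ?] /andP[? ?]] /andP[/andP[? ?] /andP[? ?]].
    move=> [e1 e2]; apply: KK'; rewrite -e1 ?e2//; by split; apply/andP.
  have := measure_negligible (measurable_box L S) H.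
  move=> H0; have E : leb2 (box L S) = ((S.1 - L.1) * (S.2 - L.2))%:E.
    by apply: leb2_box; move: LSz => [/andP[a b] /andP[c d]]; [exact: lt_trans b|exact: lt_trans d].
  have := etrans (esym H0) E.
  move=> /eqP; rewrite eqe => /eqP/esym/eqP; apply/negP; rewrite gt_eqF//.
  move: LSz => [/andP[a b] /andP[c d]].
  by rewrite mulr_gt0// subr_gt0; [exact: lt_trans b|exact: lt_trans d].
have [K0 B0] := exB _ Oz0; exists K0.
have BE : B K0 = Omega.
  (* Connectedness is applied to a subset that is nonempty, relatively open and relatively closed.
     It is relatively closed because its complement in [Omega] is the union of the other sets
     [B K]. *)
  apply: cO; first by exists z0.
  - by exists (B K0) => //; rewrite setIidr.
  - exists (~` \bigcup_(K in [set K | K <> K0]) B K).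
      by apply: open_closedC; apply: bigcup_open => K _; exact: oB.
    apply/seteqP; split=> z.
      by move=> Bz; split; [exact: BO Bz|move=> [K /= KK /uB/(_ Bz)]].
    move=> [/exB[K Bz]] nz; have [<-//|KK] := pselect (K = K0).
    by exfalso; apply: nz; exists K.
have : leb2.-negligible (Omega `&` [set z | u z <> K0]).
  apply: (negligible_cover oO) => l r lrO.
  have [[z bz]|ne] := pselect (box l r !=set0); last first.
    apply: negligibleS (negligible_set0 _) => z [bz _].
    by apply: ne; exists z.
  have : {ae leb2, forall z, box l r z -> u z = K0}.
    have [K hK] := const_on_box lrO ltac:(by case: bz => /andP[a b] _; exact: lt_trans b)
      ltac:(by case: bz => _ /andP[a b]; exact: lt_trans b).
    have BKz : B K z by exists l, r.
    suff <- : K = K0 by [].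
    apply: uB BKz _; rewrite BE; apply: lrO; exact: box_cbox.
  apply: negligibleS => x [bx ux] /= /(_ bx).
  exact: ux.
by apply: negligibleS => z /= /not_implyP[].
Qed.

End LocallyConstant.

(** * Integration by parts against polynomials *)

Section IntegrationByParts.
Context {R : realType}.
Local Notation plane := (measurableTypeR R * measurableTypeR R)%type.
Implicit Types (v w p : R * R -> R) (l r z : R * R).

Lemma pderiv_out i v l r z : (forall z, ~ box l r z -> v z = 0) ->
  ~ cbox l r z -> pderiv i v z = 0.
Proof.
move=> vb zb; rewrite /pderiv (@near_eq_derive _ _ _ v (cst 0)) ?derive_cst//.
have : nbhs z (~` cbox l r).
  by apply: open_nbhs_nbhs; split => //; exact: closed_openC (@closed_cbox _ _ _).
by apply: filterS => x xb; apply: vb => /box_cbox.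
Qed.

Lemma is_derive_slice_snd w (x y : R) : smooth_fun w ->
  is_derive y 1 (fun y => w (x, y)) (pderiv ord_max w (x, y)).
Proof.
move=> sw; have [g0 [g1 [_ _ d]]] := smooth_fun_diff sw.
have d1 : is_diff y (fun y : R => (x, y)) (fun h => (0, h)).
  exact: (is_diff_pair (is_diff_cst x y) (is_diff_id y)).
have D := is_diff_comp d1 (d (x, y)).
have dd : derivable (fun y => w (x, y)) y 1.
  by apply/derivable1_diffP; case: D.
apply: DeriveDef => //; rewrite deriveE; last by case: D.
by case: D => _ -> /=; rewrite (is_diff_pderiv _ (d _)).
Qed.

Lemma is_derive_slice_fst w (x y : R) : smooth_fun w ->
  is_derive x 1 (fun x => w (x, y)) (pderiv ord0 w (x, y)).
Proof.
move=> sw; have [g0 [g1 [_ _ d]]] := smooth_fun_diff sw.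
have d1 : is_diff x (fun x : R => (x, y)) (fun h => (h, 0)).
  exact: (is_diff_pair (is_diff_id x) (is_diff_cst y x)).
have D := is_diff_comp d1 (d (x, y)).
have dd : derivable (fun x => w (x, y)) x 1.
  by apply/derivable1_diffP; case: D.
apply: DeriveDef => //; rewrite deriveE; last by case: D.
by case: D => _ -> /=; rewrite (is_diff_pderiv _ (d _)).
Qed.

Lemma integral_derive_eq0 (F f : R -> R) (a b : R) : a < b ->
  (forall t, is_derive (t : R) (1 : R) F (f t)) -> continuous f ->
  (forall t, ~ (a < t < b) -> F t = 0) -> (forall t, ~ (a <= t <= b) -> f t = 0) ->
  (\int[lebesgue_measure]_t (f t)%:E = 0)%E.
Proof.
move=> ab dF cf F0 f0.
have cF : continuous F.
  move=> t; apply: differentiable_continuous; apply/derivable1_diffP.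
  by have [] := dF t.
transitivity (\int[lebesgue_measure]_(t in `[a, b]) (f t)%:E)%E.
  rewrite [RHS]integral_mkcond; apply: eq_integral => t _; rewrite /patch.
  case: ifPn => //; rewrite notin_setE /= in_itv /= => h; by rewrite f0.
rewrite (@continuous_FTC2 _ _ F)//.
- by rewrite !F0 ?subee//; rewrite ltxx ?andbF.
- exact: continuous_subspaceT.
- split.
  + by move=> t _; have [] := dF t.
  + by apply: cvg_at_right_filter; exact: cF.
  + by apply: cvg_at_left_filter; exact: cF.
- by move=> t _; rewrite derive1E; have [_ ->] := dF t.
Qed.

(** By Fubini the direction [i] is integrated first; each inner integral is a difference of two
    boundary values, both zero. *)
Lemma integral_pderiv_eq0 i w l r : smooth_fun w -> l.1 < r.1 -> l.2 < r.2 ->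
  (forall z, ~ box l r z -> w z = 0) ->
  leb2.-integrable setT (EFin \o pderiv i w : plane -> \bar R) ->
  (\int[leb2]_z (pderiv i w z)%:E = 0)%E.
Proof.
move=> sw h1 h2 w0 iw.
have cD j : continuous (pderiv j w).
  by apply: smooth_fun_continuous; exact: smooth_fun_pderiv.
have [i0|i0] : i = ord0 \/ i = ord_max.
- by case: i {iw} => -[|[|//]] hi; [left|right]; exact: val_inj.
- rewrite /leb2 /= -integral21_prod_meas1//; apply: integral0_eq => y _ /=.
  have cs : continuous (fun x => pderiv i w (x, y)).
    move=> x; apply/differentiable_continuous/derivable1_diffP.
    by case: (is_derive_slice_fst x y (smooth_fun_pderiv i sw)).
  apply: (@integral_derive_eq0 (fun x => w (x, y)) _ l.1 r.1) => //.
  + by move=> x; rewrite i0; exact: is_derive_slice_fst.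
  + by move=> x hx; apply: w0 => -[].
  + by move=> x hx; apply: (pderiv_out _ w0) => -[].
- rewrite /leb2 /= -integral12_prod_meas1//; apply: integral0_eq => x _ /=.
  have cs : continuous (fun y => pderiv i w (x, y)).
    move=> y; apply/differentiable_continuous/derivable1_diffP.
    by case: (is_derive_slice_snd x y (smooth_fun_pderiv i sw)).
  apply: (@integral_derive_eq0 (fun y => w (x, y)) _ l.2 r.2) => //.
  + by move=> y; rewrite i0; exact: is_derive_slice_snd.
  + by move=> y hy; apply: w0 => -[].
  + by move=> y hy; apply: (pderiv_out _ w0) => -[].
Qed.

Variable Omega : set (R * R).
Hypothesis oO : open Omega.
Hypothesis bO : bounded_set Omega.

Lemma integral_box_test_pderiv i v : box_test Omega v ->
  \int[leb2]_(z in Omega) pderiv i v z = 0.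
Proof.
move=> [sv [l [r [vb lrO]]]].
have mO := measurable_Omega oO.
have D0 : pderiv i v \_ Omega = pderiv i v.
  apply/funext => z; rewrite /patch; case: ifPn => //.
  by rewrite notin_setE => zO; rewrite (pderiv_out _ vb)// => /lrO.
have [ne|e] := pselect (box l r !=set0); last first.
  have -> : pderiv i v = fun=> 0.
    have -> : v = cst 0 by apply/funext => z; apply: vb => bz; apply: e; exists z.
    by apply/funext => z; rewrite /pderiv derive_cst.
  by rewrite Rintegral_cst// mul0r.
have ci : continuous (pderiv i v).
  by apply: smooth_fun_continuous; exact: smooth_fun_pderiv.
have ii : leb2.-integrable setT (EFin \o pderiv i v : plane -> \bar R).
  have := L2_integrable oO bO (L2_continuous oO bO ci).
  move/(integrable_mkcond _ mO); congr (_.-integrable _ _).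
  by rewrite -[in RHS]D0; apply/funext => z; rewrite /patch /=; case: ifP.
rewrite Rintegral_mkcond D0 /Rintegral.
case: ne => z [/andP[a1 a2] /andP[b1 b2]].
by rewrite (integral_pderiv_eq0 sv (lt_trans a1 a2) (lt_trans b1 b2) vb ii).
Qed.

(** The product of [p] and [v] is again a test supported in the box, so the integral of its
    derivative is zero, and the product rule splits that integral. *)
Lemma ip_pderiv_smooth i p v : smooth_fun p -> box_test Omega v ->
  ip Omega p (pderiv i v) = - ip Omega (pderiv i p) v.
Proof.
move=> sp bv; have [sv [l [r [vb lrO]]]] := bv.
have bpv : box_test Omega (fun z => p z * v z).
  split; first exact: smooth_mul.
  by exists l, r; split => // z /vb ->; rewrite mulr0.
have := integral_box_test_pderiv i bpv; rewrite pderivM//.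
have c j w : smooth_fun w -> L2 Omega (pderiv j w).
  move=> sw; apply: L2_continuous => //.
  by apply: smooth_fun_continuous; exact: smooth_fun_pderiv.
have c' w : smooth_fun w -> L2 Omega w.
  by move=> sw; apply: L2_continuous => //; exact: smooth_fun_continuous.
rewrite RintegralD; last 3 first.
- exact: measurable_Omega.
- exact: (L2_integrableM oO (c' _ sp) (c i _ sv)).
- exact: (L2_integrableM oO (c' _ sv) (c i _ sp)).
by move/addr0_eq; rewrite (ipC _ _ v) /ip => <-; rewrite opprK.
Qed.

End IntegrationByParts.

(** * Locality of weak derivatives *)

Section WeakDerivatives.
Context {R : realType}.
Implicit Types (v w p u g : R * R -> R) (l r z : R * R) (W Omega : set (R * R)).

Lemma L2_sub W Omega u : open W -> open Omega -> W `<=` Omega ->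
  L2 Omega u -> L2 W u.
Proof.
move=> oW oO WO hu; have mO := measurable_Omega oO; have mW := measurable_Omega oW.
apply: (L2_sqr oW).
  by apply: (measurable_funS mO WO); exact: L2_measurable.
have := integrableS mO mW WO (L2_integrableM oO hu hu) => /integrableP[_].
apply: le_lt_trans; rewrite le_eqVlt; apply/orP; left; apply/eqP.
by apply: eq_integral => x _; rewrite /= expr2 ger0_norm// -expr2 sqr_ge0.
Qed.

Lemma ip_sub W Omega u v : W `<=` Omega -> (forall z, ~ W z -> v z = 0) ->
  ip Omega u v = ip W u v.
Proof.
move=> WO v0; rewrite /ip Rintegral_mkcond [RHS]Rintegral_mkcond.
congr Rintegral; apply/funext => z; rewrite /patch.
have [zW|] := boolP (z \in W).
  by rewrite mem_set//; apply: WO; exact: set_mem.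
by rewrite notin_setE => /v0 ->; rewrite mulr0; case: ifP.
Qed.

(** A box test for [W] is also a test for [Omega], so the defining identity of [g] can be restricted
    to [W]. There [u] is replaced by [p], integrated by parts, and the fundamental lemma is applied
    on [W] itself. *)
Lemma wderiv_smooth Omega W i u g p : open Omega -> bounded_set Omega ->
  open W -> W `<=` Omega -> L2 Omega u -> L2 Omega g -> is_wderiv Omega [:: i] u g ->
  smooth_fun p -> u = p %[ae leb2 in W] -> g = pderiv i p %[ae leb2 in W].
Proof.
move=> oO bO oW WO hu hg ug sp up.
have bW : bounded_set W 
  by move: bO => [M [Mr h]]; exists M; split => // x Mx z /WO; exact: h.
have hp : L2 W p by apply: L2_continuous => //; exact: smooth_fun_continuous.
have hdp : L2 W (pderiv i p).
  by apply: L2_continuous => //; apply: smooth_fun_continuous; exact: smooth_fun_pderiv.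
have hgW := L2_sub oW oO WO hg; have huW := L2_sub oW oO WO hu.
have : (fun z => -1 * pderiv i p z + g z) = cst 0 %[ae leb2 in W].
  apply: (fundamental_lemma_variations oW bW); first exact: L2_lin.
  move=> v bv; have [sv [l [r [vb lrW]]]] := bv.
  have hv : L2 W v by apply: L2_continuous => //; exact: smooth_fun_continuous.
  have hdv : L2 W (pderiv i v).
    by apply: L2_continuous => //; apply: smooth_fun_continuous; exact: smooth_fun_pderiv.
  rewrite (ip_lin oW bW)//.
  have tv : test_function Omega v.
    by apply: box_test_test; split => //; exists l, r; split => //; exact: subset_trans WO.
  have := ug v tv; rewrite /= expr1 mulN1r.
  rewrite (@ip_sub W)//; last first.
    by move=> z zW; apply: (pderiv_out _ vb) => /lrW.
  rewrite (@ip_sub W Omega g)//; last first.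
    by move=> z zW; apply: vb => /box_cbox /lrW.
  rewrite (ip_ae oW huW hp hdv up) (ip_pderiv_smooth oW bW)//.
  by move/oppr_inj => ->; rewrite mulN1r addNr.
by apply: ae_imp => z H /H /=; rewrite mulN1r => /eqP; rewrite addrC subr_eq0 => /eqP.
Qed.

End WeakDerivatives.

(** * Triangles and polynomials *)

Section Triangles.
Context {R : realType}.
Implicit Types (a b c z : R * R) (T : set (R * R)).
Local Notation plane := (measurableTypeR R * measurableTypeR R)%type.

Definition affine (q : R * R * R) z : R := q.1.1 * z.1 + q.1.2 * z.2 + q.2.

Lemma affine_continuous q : continuous (affine q).
Proof.
move=> z; apply: cvgD; last exact: cvg_cst.
by apply: cvgD; apply: cvgMr; [exact: cvg_fst|exact: cvg_snd].
Qed.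

(* The [q_i] are the barycentric coordinates. *)
Lemma triangle_halfplanes T : is_triangle T -> exists q1 q2 q3,
  [/\ (q1.1.1 != 0) || (q1.1.2 != 0), (q2.1.1 != 0) || (q2.1.2 != 0),
      (q3.1.1 != 0) || (q3.1.2 != 0) &
      T = [set z | [/\ 0 <= affine q1 z, 0 <= affine q2 z & 0 <= affine q3 z]]].
Proof.
move=> [a [b [c [nc ->]]]]; move: nc; rewrite /noncollinear.
set D := (X in X != 0) => D0.
pose q2 : R * R * R := ((c.2 - a.2) / D, - (c.1 - a.1) / D,
  - (a.1 * (c.2 - a.2) - a.2 * (c.1 - a.1)) / D).
pose q3 : R * R * R := (- (b.2 - a.2) / D, (b.1 - a.1) / D,
  (a.1 * (b.2 - a.2) - a.2 * (b.1 - a.1)) / D).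
(* The constant term is chosen so that the three coordinates add up to 1; [D] is twice the signed
   area. *)
pose q1 : R * R * R := ((b.2 - c.2) / D, (c.1 - b.1) / D, 1 - q2.2 - q3.2).
exists q1, q2, q3.
have nz (x y : R) : (x = 0 -> y = 0 -> D = 0) -> (x / D != 0) || (y / D != 0).
  move=> h; rewrite !mulf_eq0 !negb_or invr_eq0 D0 !andbT.
  rewrite -negb_and; apply/negP => /andP[/eqP x0 /eqP y0].
  by move: D0; rewrite h ?eqxx.
split.
- apply: nz => h1 h2; rewrite /D.
  have -> : b.2 = c.2 by lra.
  have -> : b.1 = c.1 by lra.
  ring.
- by apply: nz => h1 /eqP; rewrite oppr_eq0 => /eqP h2; rewrite /D h1 h2; ring.
- by apply: nz => /eqP; rewrite oppr_eq0 => /eqP h1 h2; rewrite /D h1 h2; ring.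
have E (r s t : R) z : r + s + t = 1 -> z = r *: a + s *: b + t *: c ->
    [/\ s * D = (z.1 - a.1) * (c.2 - a.2) - (z.2 - a.2) * (c.1 - a.1) &
        t * D = (b.1 - a.1) * (z.2 - a.2) - (b.2 - a.2) * (z.1 - a.1)].
  move=> e ->; have -> : r = 1 - s - t by lra.
  by rewrite /= /GRing.scale /= /D; split; ring.
have e2 z : affine q2 z = ((z.1 - a.1) * (c.2 - a.2) - (z.2 - a.2) * (c.1 - a.1)) / D.
  by rewrite /affine /q2 /=; ring.
have e3 z : affine q3 z = ((b.1 - a.1) * (z.2 - a.2) - (b.2 - a.2) * (z.1 - a.1)) / D.
  by rewrite /affine /q3 /=; ring.
have e1 z : affine q1 z = 1 - affine q2 z - affine q3 z.
  by rewrite /affine /q1 /q2 /q3 /=; ring.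
apply/seteqP; split=> z.
  move=> [r [s [t [[r0 s0 t0] e ez]]]]; have [es et] := E _ _ _ _ e ez.
  have a2 : affine q2 z = s by rewrite e2 -es mulfK.
  have a3 : affine q3 z = t by rewrite e3 -et mulfK.
  by split; rewrite ?e1 ?a2 ?a3//; lra.
move=> [h1 h2 h3]; exists (affine q1 z), (affine q2 z), (affine q3 z); split => //.
  by rewrite e1; ring.
have eqp (x y : R * R) : x.1 = y.1 -> x.2 = y.2 -> x = y.
  by case: x y => [? ?] [? ?] /= -> ->.
by rewrite e1 e2 e3; apply: eqp; rewrite /= /GRing.scale /= /D; field; exact: D0.
Qed.

Lemma triangle_closed T : is_triangle T -> closed T.
Proof.
move=> /triangle_halfplanes[q1 [q2 [q3 [_ _ _ ->]]]].
have cl q : closed [set z : R * R | 0 <= affine q z].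
  apply: (@preimage_closed _ _ (affine q) [set y | 0 <= y]).
    by move=> z _; exact: affine_continuous.
  exact: closed_ge.
have -> : [set z | [/\ 0 <= affine q1 z, 0 <= affine q2 z & 0 <= affine q3 z]] =
   [set z | 0 <= affine q1 z] `&` ([set z | 0 <= affine q2 z] `&` [set z | 0 <= affine q3 z]).
  by apply/seteqP; split=> z /= [] => [? ? ?|? []]; split.
by apply: closedI; [|apply: closedI]; exact: cl.
Qed.

Lemma triangle_measurable T : is_triangle T -> measurable (T : set plane).
Proof.
move=> /triangle_closed; rewrite -openC => /open_measurable2 /measurableC.
by rewrite setCK.
Qed.

(** [W] is where all barycentric coordinates are positive; the rest of the triangle lies on three
    lines. *)
Lemma triangle_interior T : is_triangle T -> exists W, [/\ open W, W `<=` T &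
  leb2.-negligible (T `\` W)].
Proof.
move=> /triangle_halfplanes[q1 [q2 [q3 [n1 n2 n3 ->]]]].
have op q : open [set z : R * R | 0 < affine q z].
  apply: (@open_comp _ _ (affine q) [set y | 0 < y]).
    by move=> z _; exact: affine_continuous.
  exact: open_gt.
exists ([set z | 0 < affine q1 z] `&` ([set z | 0 < affine q2 z] `&` [set z | 0 < affine q3 z])).
split.
- by apply: openI; [|apply: openI]; exact: op.
- by move=> z /= [? [? ?]]; split; exact: ltW.
- have := negligibleU (null_line q1.2 n1) (negligibleU (null_line q2.2 n2) (null_line q3.2 n3)).
  apply: negligibleS => z /= [[]]; rewrite !le_eqVlt.
  move=> /predU1P[e _ _ _|h1]; first by left; rewrite -[LHS]/(affine q1 z).
  move=> /predU1P[e _ _|h2]; first by right; left; rewrite -[LHS]/(affine q2 z).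
  move=> /predU1P[e _|h3]; first by right; right; rewrite -[LHS]/(affine q3 z).
  by move=> [].
Qed.

End Triangles.

(** * Derivatives of polynomials in two variables *)

Section Polynomials.
Context {R : realType}.
Implicit Types (z : R * R) (c d : nat -> nat -> R).

Lemma poly2D k a c d z :
  poly2 k (fun i j => a * c i j + d i j) z = a * poly2 k c z + poly2 k d z.
Proof.
rewrite /poly2 mulr_sumr -big_split; apply: eq_bigr => i _ /=.
rewrite mulr_sumr -big_split; apply: eq_bigr => j _ /=; ring.
Qed.

Lemma smooth_sum (I : Type) (s : seq I) (P : pred I) (F : I -> R * R -> R) :
  (forall i, smooth_fun (F i)) -> smooth_fun (fun z => \sum_(i <- s | P i) F i z).
Proof.
move=> h; elim: s => [|i s ih].
  have := smooth_cst (0 : R); congr smooth_fun; apply/funext => z; by rewrite big_nil.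
have [Pi|Pi] := boolP (P i).
  have := smooth_add (h i) ih; congr smooth_fun; apply/funext => z.
  by rewrite big_cons Pi.
move: ih; congr smooth_fun; apply/funext => z; by rewrite big_cons (negbTE Pi).
Qed.

Lemma pderiv_sum m (I : Type) (s : seq I) (P : pred I) (F : I -> R * R -> R) :
  (forall i, smooth_fun (F i)) -> pderiv m (fun z => \sum_(i <- s | P i) F i z) =
  (fun z => \sum_(i <- s | P i) pderiv m (F i) z).
Proof.
move=> h; elim: s => [|i s ih].
  rewrite (_ : (fun z => _) = cst 0); last by apply/funext => z; rewrite big_nil.
  by apply/funext => z; rewrite big_nil /pderiv derive_cst.
have [Pi|Pi] := boolP (P i); last first.
  rewrite (_ : (fun z => \sum_(j <- i :: s | P j) F j z) =
    fun z => \sum_(j <- s | P j) F j z); last first.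
    by apply/funext => z; rewrite big_cons (negbTE Pi).
  by rewrite ih; apply/funext => z; rewrite big_cons (negbTE Pi).
rewrite (_ : (fun z => \sum_(j <- i :: s | P j) F j z) =
    F i + (fun z => \sum_(j <- s | P j) F j z)); last first.
  by apply/funext => z; rewrite big_cons Pi.
apply/funext => z; rewrite /pderiv deriveD; last 2 first.
- by apply: diff_derivable; exact: smooth_fun_differentiable.
- by apply: diff_derivable; apply: smooth_fun_differentiable; exact: smooth_sum.
by rewrite big_cons Pi; congr (_ + _); have := congr1 (fun f => f z) ih.
Qed.

Lemma smooth_fstX n : smooth_fun (fun z : R * R => z.1 ^+ n).
Proof.
elim: n => [|n ih]; first exact: (smooth_cst 1).
have := smooth_mul smooth_fst ih; congr smooth_fun.
by apply/funext => z; rewrite exprS.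
Qed.

Lemma smooth_sndX n : smooth_fun (fun z : R * R => z.2 ^+ n).
Proof.
elim: n => [|n ih]; first exact: (smooth_cst 1).
have := smooth_mul smooth_snd ih; congr smooth_fun.
by apply/funext => z; rewrite exprS.
Qed.

Lemma smooth_monomial (a : R) i j : smooth_fun (fun z => a * z.1 ^+ i * z.2 ^+ j).
Proof.
by apply: smooth_mul (smooth_sndX j); apply: smooth_mul (smooth_fstX i); exact: smooth_cst.
Qed.

Lemma smooth_poly2 k c : smooth_fun (poly2 k c).
Proof. by apply: smooth_sum => i; apply: smooth_sum => j; exact: smooth_monomial. Qed.

Lemma is_derive_pow n (t : R) : is_derive t (1 : R) (fun t => t ^+ n) (n%:R * t ^+ n.-1).
Proof.
have := @is_deriveX R _ id n t 1 1 (is_derive_id _ _).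
rewrite /GRing.scale /= mulr1; congr is_derive.
by apply/funext => y; rewrite fctE.
Qed.

Lemma pderiv_monomial m (a : R) i j z :
  pderiv m (fun z => a * z.1 ^+ i * z.2 ^+ j) z =
  if m == ord0 then a * (i%:R * z.1 ^+ i.-1) * z.2 ^+ j
  else a * z.1 ^+ i * (j%:R * z.2 ^+ j.-1).
Proof.
have sa : smooth_fun (fun z : R * R => a * z.1 ^+ i).
  by apply: smooth_mul (smooth_fstX i); exact: smooth_cst.
rewrite (pderivM _ sa (smooth_sndX j)) (pderivM _ (smooth_cst a) (smooth_fstX i)).
have -> : pderiv m (fun=> a) z = 0 by rewrite /pderiv derive_cst.
have [f1 f2] := pderiv_comp_fst (is_derive_pow i z.1).
have [s1 s2] := pderiv_comp_snd (is_derive_pow j z.2).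
have [m0|m0] : m = ord0 \/ m = ord_max.
- by case: m => -[|[|//]] hi; [left|right]; exact: val_inj.
- by rewrite m0 eqxx f1 s2; ring.
- by rewrite m0 /= f2 s1; ring.
Qed.

Lemma pderiv_poly2 m k c : exists d, pderiv m (poly2 k.+1 c) = poly2 k d.
Proof.
have E z : pderiv m (poly2 k.+1 c) z = \sum_(i < k.+2) \sum_(j < k.+2 | (i + j <= k.+1)%N)
    (if m == ord0 then c i j * (i%:R * z.1 ^+ i.-1) * z.2 ^+ j
     else c i j * z.1 ^+ i * (j%:R * z.2 ^+ j.-1)).
  rewrite /poly2 pderiv_sum; last by move=> i; apply: smooth_sum => j; exact: smooth_monomial.
  apply: eq_bigr => i _; rewrite pderiv_sum; last by move=> j; exact: smooth_monomial.
  by apply: eq_bigr => j _; rewrite pderiv_monomial.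
exists (fun i j => if m == ord0 then c i.+1 j * i.+1%:R else c i j.+1 * j.+1%:R).
apply/funext => z; rewrite E /poly2; case: (m == ord0).
(* Differentiation in the first variable kills the row of exponent 0. In the remaining rows the last
   column has total degree above the bound, so it is absent from the sum. *)
- rewrite big_ord_recl big1 ?add0r; last by move=> j _; rewrite /= !(mul0r, mulr0).
  apply: eq_bigr => i _; rewrite big_mkcond big_ord_recr /= ifF ?addr0.
    rewrite [RHS]big_mkcond; apply: eq_bigr => j _ /=.
    by rewrite /bump /= add1n addSn ltnS; case: ifP => // _; ring.
  by rewrite /bump /= add1n; apply/negbTE; rewrite -ltnNge addSn ltnS leq_addl.
(* In the last row the degree bound leaves only exponent 0 of the second variable, which
   differentiation kills; so it does in the first column of every other row. *)
- rewrite big_ord_recr /= [X in _ + X]big1 ?addr0; last first.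
    move=> j hj; have -> : (j : nat) = 0%N.
      by apply/eqP; rewrite -leqn0 -(leq_add2l k.+1) addn0.
    by rewrite mul0r mulr0.
  apply: eq_bigr => i _; rewrite big_mkcond big_ord_recl /= !(mul0r, mulr0) if_same add0r.
  rewrite [RHS]big_mkcond; apply: eq_bigr => j _ /=.
  by rewrite /bump /= add1n addnS ltnS; case: ifP => // _; ring.
Qed.

End Polynomials.

(** * Projections for a semi-inner product *)

Section Projection.
Context {R : realType} {V : lmodType R}.
(** [B] is total but linear only on [D]: it will be [ipt], whose integrals are meaningful sums of
    products only on square-integrable fields. *)
Variables (D : set V) (B : V -> V -> R).
Hypothesis D_lin : forall a u v, D u -> D v -> D (a *: u + v).
Hypothesis D_0 : D 0.
Hypothesis B_sym : forall u v, B u v = B v u.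
Hypothesis B_lin : forall a u v w, D u -> D v -> D w ->
  B (a *: u + v) w = a * B u w + B v w.
Hypothesis B_ge0 : forall u, 0 <= B u u.

Lemma B_linr a u v w : D u -> D v -> D w -> B w (a *: u + v) = a * B w u + B w v.
Proof. by move=> *; rewrite B_sym B_lin// (B_sym u) (B_sym v). Qed.

Lemma D_sub u v : D u -> D v -> D (u - v).
Proof. by move=> hu hv; rewrite addrC -scaleN1r; exact: D_lin. Qed.

Lemma D_scale a u : D u -> D (a *: u).
Proof. by move=> hu; rewrite -[_ *: _]addr0; exact: D_lin. Qed.

Lemma B_subl u v w : D u -> D v -> D w -> B (u - v) w = B u w - B v w.
Proof. by move=> *; rewrite addrC -scaleN1r B_lin// mulN1r addrC. Qed.

Lemma B_0l w : D w -> B 0 w = 0.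
Proof. by move=> hw; have := B_subl D_0 D_0 hw; rewrite !subr0 subrr. Qed.

Lemma cauchy_schwarz u v : D u -> D v -> B u v ^+ 2 <= B u u * B v v.
Proof.
move=> hu hv; have ge t : 0 <= t ^+ 2 * B u u + 2 * t * B u v + B v v.
  have := B_ge0 (t *: u + v); have h := D_lin t hu hv.
  rewrite B_lin// !B_linr// (B_sym v u).
  by congr (0 <= _); ring.
have [B0|B0] := eqVneq (B u u) 0.
  suff -> : B u v = 0 by rewrite expr0n B0 mul0r.
  (* Without a quadratic term the expression is affine in [t]; at this [t] it equals -1. *)
  apply/eqP/negPn/negP => n0; have := ge (- (B v v + 1) / (2 * B u v)).
  rewrite B0 mulr0 add0r.
  have -> : 2 * (- (B v v + 1) / (2 * B u v)) * B u v = - (B v v + 1) by field.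
  lra.
have Bp : 0 < B u u by rewrite lt_neqAle eq_sym B0 B_ge0.
(* The minimiser of the quadratic in [t]. *)
have := ge (- B u v / B u u).
have -> : (- B u v / B u u) ^+ 2 * B u u + 2 * (- B u v / B u u) * B u v + B v v =
  (B u u * B v v - B u v ^+ 2) / B u u by field.
by rewrite pmulr_lge0 ?invr_gt0// subr_ge0.
Qed.

Lemma B_null u v : D u -> D v -> B u u = 0 -> B u v = 0.
Proof.
move=> hu hv h; have := cauchy_schwarz hu hv; rewrite h mul0r => h'.
by apply/eqP; rewrite -sqrf_eq0 eq_le h' sqr_ge0.
Qed.

(* [span_mod s u]: [u] is a linear combination of [s] up to a null vector. *)
Fixpoint span_mod (s : seq V) (u : V) : Prop :=
  if s is e :: s' then exists c : R, span_mod s' (u - c *: e) else B u u = 0.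

Lemma span_mod_lin s a u v : (forall e, e \in s -> D e) -> D u -> D v ->
  span_mod s u -> span_mod s v -> span_mod s (a *: u + v).
Proof.
elim: s u v => [|e s ih] u v De hu hv /=.
  move=> nu nv; have h := D_lin a hu hv.
  rewrite B_lin// B_linr// B_linr// nu nv (B_sym v) (B_null hu hv nu).
  ring.
move=> [c hc] [d hd]; exists (a * c + d).
have he : D e by apply: De; rewrite mem_head.
have := ih (u - c *: e) (v - d *: e); rewrite scalerBr scalerA => H.
have -> : a *: u + v - (a * c + d) *: e = (a *: u - (a * c) *: e) + (v - d *: e).
  by rewrite scalerDl opprD addrACA.
apply: H => //; last by apply: D_sub => //; exact: D_scale.
  by move=> x xs; apply: De; rewrite inE xs orbT.
by apply: D_sub => //; exact: D_scale.
Qed.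

Lemma span_mod_null s u : B u u = 0 -> span_mod s u.
Proof.
by elim: s => [//|e s ih] nu /=; exists 0; rewrite scale0r subr0; exact: ih.
Qed.

Lemma span_mod_mem s e : e \in s -> span_mod s e.
Proof.
elim: s => [//|e' s ih]; rewrite inE => /predU1P[->|es] /=.
  by exists 1; rewrite scale1r subrr; apply: span_mod_null; exact: B_0l.
by exists 0; rewrite scale0r subr0; exact: ih.
Qed.

Lemma span_mod_sum s (I : Type) (r : seq I) (F : I -> V) (c : I -> R) :
  (forall e, e \in s -> D e) -> (forall i, F i \in s) ->
  D (\sum_(i <- r) c i *: F i) /\ span_mod s (\sum_(i <- r) c i *: F i).
Proof.
move=> De hF; elim: r => [|i r [ihD ih]].
  by rewrite big_nil; split => //; apply: span_mod_null => //; exact: B_0l.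
rewrite big_cons; split; first by apply: D_lin => //; exact: De.
by apply: span_mod_lin => //; [exact: De|exact: span_mod_mem].
Qed.

(** The list [s] spans modulo null vectors a space that contains [W], but its members need not lie
    in [W], so they cannot simply be orthogonalised. Dropping one vector of [s] leaves the subspace
    [W'], of codimension at most one in [W]; the projection onto [W'] is corrected along a single
    direction [d] orthogonal to it. *)
Lemma projection_exists s (W : set V) (f : V) :
  (forall e, e \in s -> D e) -> W `<=` D -> W 0 ->
  (forall a u v, W u -> W v -> W (a *: u + v)) ->
  (forall w, W w -> span_mod s w) -> D f ->
  exists2 p, W p & forall w, W w -> B (f - p) w = 0.
Proof.
elim: s W f => [|e s ih] W f De WD W0 Wl Ws Df.
  exists 0 => // w Ww; rewrite subr0 B_sym; apply: B_null; [exact: WD|by []|].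
  exact: Ws w Ww.
have De' x : x \in s -> D x by move=> xs; apply: De; rewrite inE xs orbT.
have he : D e by apply: De; rewrite mem_head.
pose W' := [set w | W w /\ span_mod s w].
have W'D : W' `<=` D by move=> w [/WD].
have W'0 : W' 0 by split=> //; apply: span_mod_null => //; exact: B_0l.
have W'l a u v : W' u -> W' v -> W' (a *: u + v).
  move=> [Wu su] [Wv sv]; split; first exact: Wl.
  by apply: span_mod_lin => //; exact: WD.
have [p Wp hp] := ih W' f De' W'D W'0 W'l (fun w h => h.2) Df.
have [sub|] := pselect (forall w, W w -> span_mod s w).
  by exists p => [|w Ww]; [case: Wp|apply: hp; split=> //; exact: sub].
move=> /existsNP[w0 /not_implyP[Ww0 nw0]].
have [c0 hc0] := Ws _ Ww0.
have c00 : c0 != 0.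
  by apply/eqP => c00; apply: nw0; move: hc0; rewrite c00 scale0r subr0.
have [q Wq hq] := ih W' w0 De' W'D W'0 W'l (fun w h => h.2) (WD _ Ww0).
pose d := w0 - q.
have Dq := W'D _ Wq; have Dp := W'D _ Wp; have Dw0 := WD _ Ww0.
have Dd : D d by exact: D_sub.
have Wd : W d by rewrite /d addrC -scaleN1r; apply: Wl => //; case: Wq.
have dec w : W w -> exists k w', W' w' /\ w = k *: d + w'.
  (* [c] and [c0] are the coefficients of [w] and [w0] along [e]; their quotient is what cancels the
     [e] component. *)
  move=> Ww; have [c hc] := Ws _ Ww; exists (c / c0), (w - (c / c0) *: d); split; last first.
    by rewrite addrC subrK.
  have -> : w - (c / c0) *: d = (c / c0) *: q + (- (c / c0) *: w0 + w).
    by rewrite /d scalerBr opprB scaleNr addrCA; congr (_ + _); exact: addrC.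
  apply: W'l => //; split; first exact: Wl.
  have -> : - (c / c0) *: w0 + w = - (c / c0) *: (w0 - c0 *: e) + (w - c *: e).
    have kc : - (c / c0) * c0 = - c by field.
    by rewrite scalerBr scalerA kc (scaleNr c) opprK addrACA subrr addr0.
  apply: span_mod_lin => //; apply: D_sub => //; try exact: D_scale.
  exact: WD.
have dW' w : W' w -> B d w = 0 by move=> h; exact: hq.
have Dfp := D_sub Df Dp.
(* [d] may be null without being zero; it is then orthogonal to everything in [D], and no correction
   is called for. *)
have [B0|B0] := eqVneq (B d d) 0.
  exists p => [|w /dec[k [w' [Ww' ->]]]]; first by case: Wp.
  have Dw' := W'D _ Ww'.
  by rewrite B_linr// (hp _ Ww') addr0 B_sym (B_null Dd Dfp B0) mulr0.
exists (((B (f - p) d) / B d d) *: d + p) => [|w /dec[k [w' [Ww' ->]]]].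
  by apply: Wl => //; case: Wp.
have Dw' := W'D _ Ww'; have Dkd := D_scale (B (f - p) d / B d d) Dd.
have -> : f - (B (f - p) d / B d d *: d + p) = (f - p) - (B (f - p) d / B d d) *: d.
  by rewrite opprD addrA addrAC.
have Dk := D_lin k Dd Dw'.
rewrite B_subl// B_linr// (hp _ Ww') addr0.
have -> : B (B (f - p) d / B d d *: d) (k *: d + w') = B (f - p) d / B d d * B d (k *: d + w').
  have := B_lin (B (f - p) d / B d d) Dd D_0 Dk.
  by rewrite addr0 (B_0l Dk) addr0.
rewrite (B_linr k Dd Dw' Dd) (dW' _ Ww') addr0; field.
exact: B0.
Qed.

Definition seminorm u := Num.sqrt (B u u).

Lemma seminorm_ge0 u : 0 <= seminorm u. Proof. exact: sqrtr_ge0. Qed.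

Lemma sqr_seminorm u : seminorm u ^+ 2 = B u u.
Proof. by rewrite sqr_sqrtr. Qed.

Lemma B_le_seminorm u v : D u -> D v -> `|B u v| <= seminorm u * seminorm v.
Proof.
move=> hu hv; rewrite -sqrtrM// -sqrtr_sqr; apply: ler_wsqrtr.
exact: cauchy_schwarz.
Qed.

Lemma B_add u v : D u -> D v -> B (u + v) (u + v) = B u u + 2 * B u v + B v v.
Proof.
move=> hu hv; have h := D_lin 1 hu hv; rewrite -[u in u + v]scale1r.
by rewrite B_lin// !B_linr// (B_sym v u); ring.
Qed.

Lemma seminorm_add u v : D u -> D v -> seminorm (u + v) <= seminorm u + seminorm v.
Proof.
move=> hu hv; rewrite -(ler_pXn2r (_ : (0 < 2)%N)) ?nnegrE ?addr_ge0 ?seminorm_ge0//.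
rewrite sqr_seminorm B_add// sqrrD !sqr_seminorm -mulr_natl.
by have := le_trans (ler_norm _) (B_le_seminorm hu hv); lra.
Qed.

(** Pythagoras; it turns orthogonality of an error into best approximation. *)
Lemma seminorm_orthogonal u v : D u -> D v -> B u v = 0 ->
  seminorm u <= seminorm (u + v).
Proof.
by move=> hu hv h; apply: ler_wsqrtr; rewrite B_add// h mulr0 addr0 lerDl.
Qed.

(* For [r = P sigma - sigmah], orthogonality gives [B r r = - B r (S - Sh)]. *)
Lemma mixed_error (X : set V) (sigma sigmah P S Sh : V) :
  X `<=` D -> (forall u v, X u -> X v -> X (u - v)) ->
  D sigma -> D S -> D Sh -> X sigmah -> X P ->
  (forall tau, X tau -> B (sigma - P) tau = 0) ->
  (forall tau, X tau -> B sigma tau + B tau S = B sigmah tau + B tau Sh) ->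
  seminorm (sigma - sigmah) <= seminorm (sigma - P) + seminorm (S - Sh).
Proof.
move=> XD Xs Ds DS DSh Xsh XP hP h.
have Dsh := XD _ Xsh; have DP := XD _ XP; have Xr := Xs _ _ XP Xsh.
have Dr := XD _ Xr; have Dd := D_sub DS DSh.
rewrite (_ : sigma - sigmah = (sigma - P) + (P - sigmah)); last by rewrite addrA subrK.
apply: le_trans (seminorm_add (D_sub Ds DP) Dr) _; rewrite lerD2l.
have e1 : B (P - sigmah) (P - sigmah) = - B (P - sigmah) (S - Sh).
  have := hP _ Xr; have := h _ Xr; rewrite (B_subl Ds DP Dr) (B_subl DP Dsh Dr).
  rewrite (B_sym _ (S - Sh)) (B_subl DS DSh Dr) (B_sym S) (B_sym Sh); lra.
have [n0|n0] := eqVneq (seminorm (P - sigmah)) 0; first by rewrite n0 seminorm_ge0.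
rewrite -(ler_pM2l (_ : 0 < seminorm (P - sigmah))); last first.
  by rewrite lt_neqAle eq_sym n0 seminorm_ge0.
rewrite -expr2 sqr_seminorm e1; apply: le_trans (ler_norm _) _.
by rewrite normrN; exact: B_le_seminorm.
Qed.

End Projection.

(** * Weak derivatives and the operator Curl *)

Section SobolevSpaces.
Context {R : realType}.
Variable Omega : set (R * R).
Hypothesis oO : open Omega.
Hypothesis bO : bounded_set Omega.
Implicit Types (u v g h : R * R -> R) (s : seq 'I_2) (i : 'I_2).

Lemma L2_pderivs s v : test_function Omega v -> L2 Omega (pderivs s v).
Proof.
move=> [sv _ _]; apply: L2_continuous => // z.
by apply: differentiable_continuous; exact: sv.
Qed.

Lemma is_wderiv_lin s a u v g h : L2 Omega u -> L2 Omega v -> L2 Omega g ->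
  L2 Omega h -> is_wderiv Omega s u g -> is_wderiv Omega s v h ->
  is_wderiv Omega s (fun x => a * u x + v x) (fun x => a * g x + h x).
Proof.
move=> hu hv hg hh ug vh w tw; have h0 : L2 Omega w := L2_pderivs [::] tw.
rewrite (ip_lin oO bO a hu hv (L2_pderivs s tw)) ug// vh//.
by rewrite (ip_lin oO bO a hg hh h0); ring.
Qed.

Lemma is_wderiv_unique s u g h : L2 Omega g -> L2 Omega h ->
  is_wderiv Omega s u g -> is_wderiv Omega s u h -> g = h %[ae leb2 in Omega].
Proof.
move=> hg hh ug uh.
have : (fun x => -1 * h x + g x) = cst 0 %[ae leb2 in Omega].
  apply: (fundamental_lemma_variations oO bO); first exact: L2_lin.
  move=> v /box_test_test tv; have h0 : L2 Omega v := L2_pderivs [::] tv.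
  have n0 : (-1) ^+ size s != 0 :> R by rewrite signr_eq0.
  rewrite (ip_lin oO bO (-1) hh hg h0); have := ug v tv; rewrite uh//.
  by move/(mulfI n0) => ->; ring.
by apply: ae_imp => z H /H /=; lra.
Qed.

(** The default value of [xget] is not reached once some weak derivative exists. *)
Lemma wderivP s u : (exists2 g, L2 Omega g & is_wderiv Omega s u g) ->
  L2 Omega (wderiv Omega s u) /\ is_wderiv Omega s u (wderiv Omega s u).
Proof.
move=> [g hg ug].
have : exists x, [set g | L2 Omega g /\ is_wderiv Omega s u g] x by exists g.
exact: xgetPex.
Qed.

Lemma Hm1_wderiv i u : Hm Omega 1 u ->
  L2 Omega (wderiv Omega [:: i] u) /\ is_wderiv Omega [:: i] u (wderiv Omega [:: i] u).
Proof. by move=> [_ h]; apply: wderivP; exact: h. Qed.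

Lemma Hm_lin m a u v : Hm Omega m u -> Hm Omega m v ->
  Hm Omega m (fun x => a * u x + v x).
Proof.
move=> [hu du] [hv dv]; split; first exact: L2_lin.
move=> s hs; have [g hg ug] := du s hs; have [h hh vh] := dv s hs.
by exists (fun x => a * g x + h x); [exact: L2_lin|exact: is_wderiv_lin].
Qed.

Lemma is_wderiv0 s : is_wderiv Omega s (cst 0) (cst 0).
Proof.
have h0 v : ip Omega (cst 0) v = 0.
  by rewrite /ip; under eq_Rintegral do rewrite mul0r;
    rewrite Rintegral_cst ?mul0r//; exact: measurable_Omega.
by move=> v _; rewrite !h0 mulr0.
Qed.

Lemma Hm_0 m : Hm Omega m (cst 0).
Proof.
split; first exact: L2_cst.
by move=> s _; exists (cst 0); [exact: L2_cst|exact: is_wderiv0].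
Qed.

(** Only almost everywhere, because the representatives for [u], for [v] and for their combination
    are chosen independently. *)
Lemma wderiv_lin i a u v : Hm Omega 1 u -> Hm Omega 1 v ->
  wderiv Omega [:: i] (fun x => a * u x + v x) =
  (fun x => a * wderiv Omega [:: i] u x + wderiv Omega [:: i] v x) %[ae leb2 in Omega].
Proof.
move=> hu hv; have [h1 d1] := Hm1_wderiv i hu; have [h2 d2] := Hm1_wderiv i hv.
have [h3 d3] := Hm1_wderiv i (Hm_lin a hu hv).
apply: (is_wderiv_unique h3 _ d3); first exact: L2_lin.
by apply: is_wderiv_lin => //; [case: hu|case: hv].
Qed.

Lemma wderiv_0 i : wderiv Omega [:: i] (cst 0) = cst 0 %[ae leb2 in Omega].
Proof.
have [h1 d1] := Hm1_wderiv i (Hm_0 1).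
by apply: (is_wderiv_unique h1 _ d1); [exact: L2_cst|exact: is_wderiv0].
Qed.

End SobolevSpaces.

(** * The semi-inner product on tensor fields *)

Section TensorFields.
Context {R : realType}.
Variable Omega : set (R * R).
Hypothesis oO : open Omega.
Hypothesis bO : bounded_set Omega.
Variable l : nat.
Implicit Types (psi chi tau : R * R -> tensor R l).

Lemma fieldE a psi chi x J : (a *: psi + chi) x J = a * psi x J + chi x J.
Proof. by rewrite !fctE /= !ffunE. Qed.

Lemma field0E x J : (0 : R * R -> tensor R l) x J = 0.
Proof.
have -> : (0 : R * R -> tensor R l) x = 0 by [].
by rewrite ffunE.
Qed.

Lemma L2t_lin a psi chi : L2t Omega psi -> L2t Omega chi -> L2t Omega (a *: psi + chi).
Proof.
move=> h1 h2 J; have := L2_lin a (h1 J) (h2 J); congr L2.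
by apply/funext => x; rewrite fieldE.
Qed.

Lemma L2t_0 : L2t Omega (0 : R * R -> tensor R l).
Proof.
move=> J; have := L2_cst oO bO 0; congr L2.
by apply/funext => x; rewrite field0E.
Qed.

Lemma Rintegral_sum (I : Type) (s : seq I) (F : I -> R * R -> R) :
  (forall i, leb2.-integrable Omega (EFin \o F i)) ->
  \int[leb2]_(x in Omega) (\sum_(i <- s) F i x) =
  \sum_(i <- s) \int[leb2]_(x in Omega) F i x.
Proof.
move=> h; have mO := measurable_Omega oO.
(* Integrability of the partial sums is carried through the induction, since additivity of the
   integral requires it. *)
suff [] : leb2.-integrable Omega (EFin \o (fun x => \sum_(i <- s) F i x)) /\
  \int[leb2]_(x in Omega) (\sum_(i <- s) F i x) =
  \sum_(i <- s) \int[leb2]_(x in Omega) F i x by [].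
elim: s => [|i s [ih1 ih2]].
  rewrite (_ : (fun x => _) = cst 0); last by apply/funext => x; rewrite big_nil.
  rewrite big_nil; split; last by rewrite Rintegral_cst// mul0r.
  exact: (L2_integrable oO bO (L2_cst oO bO 0)).
rewrite (_ : (fun x => _) = fun x => F i x + \sum_(j <- s) F j x); last first.
  by apply/funext => x; rewrite big_cons.
split; last by rewrite RintegralD// big_cons ih2.
have := integrableD mO (h i) ih1; congr (_.-integrable _ _).
Qed.

Lemma iptE psi chi : L2t Omega psi -> L2t Omega chi ->
  ipt Omega psi chi = \sum_J ip Omega (fun x => psi x J) (fun x => chi x J).
Proof.
move=> h1 h2; rewrite /ipt /tdot Rintegral_sum//.
by move=> J; exact: (L2_integrableM oO (h1 J) (h2 J)).
Qed.

Lemma iptC psi chi : ipt Omega psi chi = ipt Omega chi psi.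
Proof.
by apply: eq_Rintegral => x _; apply: eq_bigr => J _; rewrite mulrC.
Qed.

Lemma ipt_lin a psi chi tau : L2t Omega psi -> L2t Omega chi -> L2t Omega tau ->
  ipt Omega (a *: psi + chi) tau = a * ipt Omega psi tau + ipt Omega chi tau.
Proof.
move=> h1 h2 h3; rewrite !iptE//; last exact: L2t_lin.
rewrite mulr_sumr -big_split; apply: eq_bigr => J _ /=.
rewrite -(ip_lin oO bO a (h1 J) (h2 J) (h3 J)); congr ip.
by apply/funext => x; rewrite fieldE.
Qed.

Lemma ipt_ge0 psi : 0 <= ipt Omega psi psi.
Proof.
by apply: Rintegral_ge0 => x _; apply: sumr_ge0 => J _; rewrite -expr2 sqr_ge0.
Qed.

Lemma ipt_ae psi chi tau : L2t Omega psi -> L2t Omega chi -> L2t Omega tau ->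
  psi = chi %[ae leb2 in Omega] -> ipt Omega psi tau = ipt Omega chi tau.
Proof.
move=> h1 h2 h3 h; rewrite !iptE//; apply: eq_bigr => J _.
apply: (ip_ae oO (h1 J) (h2 J) (h3 J)).
by apply: ae_imp h => x H /H ->.
Qed.

Lemma ae_field psi chi :
  (forall J, (fun x => psi x J) = (fun x => chi x J) %[ae leb2 in Omega]) ->
  psi = chi %[ae leb2 in Omega].
Proof.
move=> h; apply: ae_imp (ae_all h) => x H Ox; apply/ffunP => J; exact: H.
Qed.

Lemma ipt_eq0 psi : L2t Omega psi -> ipt Omega psi psi = 0 ->
  psi = cst 0 %[ae leb2 in Omega].
Proof.
move=> h; rewrite iptE// => /eqP; rewrite psumr_eq0; last by move=> J _; exact: ip_ge0.
move=> /allP H; apply: ae_field => J.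
have := ip_eq0 oO (h J) (eqP (H J (mem_index_enum J))).
by apply: ae_imp => x Hx /Hx /= ->; rewrite ffunE.
Qed.

Lemma L2t_sub psi chi : L2t Omega psi -> L2t Omega chi -> L2t Omega (psi - chi).
Proof. by move=> h1 h2; rewrite addrC -scaleN1r; exact: L2t_lin. Qed.

Lemma ipt_ae0 psi tau : L2t Omega psi -> L2t Omega tau ->
  psi = cst 0 %[ae leb2 in Omega] -> ipt Omega psi tau = 0.
Proof.
move=> h1 h2 h; rewrite (ipt_ae h1 L2t_0 h2 h) iptE//; last exact: L2t_0.
apply: big1 => J _; rewrite /ip; under eq_Rintegral do rewrite field0E mul0r.
by rewrite Rintegral_cst ?mul0r//; exact: measurable_Omega.
Qed.

Lemma symmetric_ae_lin a psi chi : symmetric_ae Omega psi -> symmetric_ae Omega chi ->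
  symmetric_ae Omega (a *: psi + chi).
Proof.
move=> h1 h2; apply: ae_imp (ae_and h1 h2) => x [s1 s2] Ox p J.
by rewrite !fieldE s1// s2.
Qed.

Lemma symmetric_ae_0 : symmetric_ae Omega (0 : R * R -> tensor R l).
Proof. by apply: ae_true => x _ p J; rewrite !field0E. Qed.

End TensorFields.

Section CurlOperators.
Context {R : realType}.
Variable Omega : set (R * R).
Hypothesis oO : open Omega.
Hypothesis bO : bounded_set Omega.
Variable l : nat.
Implicit Types (beta gamma : R * R -> tensor R l) (J : l.+1.-tuple 'I_2).

Definition init_index J : l.-tuple 'I_2 :=
  [tuple tnth J (widen_ord (leqnSn l) i) | i < l].

Lemma CurlE beta x J : Curl Omega beta x J =
  if tnth J ord_max == ord0 then - wderiv Omega [:: ord_max] (fun y => beta y (init_index J)) x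
  else wderiv Omega [:: ord0] (fun y => beta y (init_index J)) x.
Proof. by rewrite ffunE. Qed.

Definition H1t beta := forall J : l.-tuple 'I_2, Hm Omega 1 (fun x => beta x J).

Lemma H1t_lin a beta gamma : H1t beta -> H1t gamma -> H1t (a *: beta + gamma).
Proof.
move=> h1 h2 J; have := Hm_lin oO bO a (h1 J) (h2 J); congr Hm.
by apply/funext => x; rewrite fieldE.
Qed.

Lemma H1t_0 : H1t 0.
Proof.
move=> J; have := Hm_0 oO bO 1; congr Hm.
by apply/funext => x; rewrite field0E.
Qed.

Lemma L2t_Curl beta : H1t beta -> L2t Omega (Curl Omega beta).
Proof.
move=> h J; case: (boolP (tnth J ord_max == ord0)) => hJ.
  have := L2Z oO bO (-1) (Hm1_wderiv ord_max (h (init_index J))).1; congr L2.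
  by apply/funext => x; rewrite CurlE hJ mulN1r.
have := (Hm1_wderiv ord0 (h (init_index J))).1; congr L2.
by apply/funext => x; rewrite CurlE (negbTE hJ).
Qed.

Lemma Curl_lin a beta gamma : H1t beta -> H1t gamma ->
  Curl Omega (a *: beta + gamma) = a *: Curl Omega beta + Curl Omega gamma
  %[ae leb2 in Omega].
Proof.
move=> h1 h2; apply: ae_field => J.
pose i : 'I_2 := if tnth J ord_max == ord0 then ord_max else ord0.
have := wderiv_lin oO bO i a (h1 (init_index J)) (h2 (init_index J)).
apply: ae_imp => x H /H; rewrite fieldE !CurlE /i.
rewrite (_ : (fun y => (a *: beta + gamma) y (init_index J)) =
  fun y => a * beta y (init_index J) + gamma y (init_index J)); last first.
  by apply/funext => y; rewrite fieldE.
by case: ifP => _ ->; rewrite // opprD mulrN.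
Qed.

Lemma Curl_0 : Curl Omega (0 : R * R -> tensor R l) = 0 %[ae leb2 in Omega].
Proof.
apply: ae_field => J.
pose i : 'I_2 := if tnth J ord_max == ord0 then ord_max else ord0.
apply: ae_imp (wderiv_0 oO bO i) => x H /H; rewrite CurlE /i.
rewrite (_ : (fun y => (0 : R * R -> tensor R l) y (init_index J)) = cst 0); last first.
  by apply/funext => y; rewrite field0E.
by rewrite field0E; case: ifP => _ ->; rewrite ?oppr0.
Qed.

Lemma symt_lin m a (A B : tensor R m) : symt (a *: A + B) = a *: symt A + symt B.
Proof.
apply/ffunP => J; rewrite !ffunE /GRing.scale /= mulrCA -mulrDr; congr (_ * _).
by rewrite mulr_sumr -big_split; apply: eq_bigr => p _; rewrite !ffunE.
Qed.

Lemma symt_0 m : symt (0 : tensor R m) = 0.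
Proof. by apply/ffunP => J; rewrite !ffunE big1 ?mulr0// => p _; rewrite ffunE. Qed.

(** Right translation by [p] is a bijection of the symmetric group, so it only reorders the sum. *)
Lemma symt_symmetric m (A : tensor R m) : symmetric_tensor (symt A).
Proof.
move=> p J; rewrite !ffunE; congr (_ * _).
rewrite [RHS](reindex_inj (mulIg p)); apply: eq_bigr => q _; congr (A _).
by apply: eq_from_tnth => i; rewrite !tnth_mktuple permM.
Qed.

Lemma symCurlE beta x J : symCurl Omega beta x J =
  (l.+1`!)%:R^-1 * \sum_(p : 'S_l.+1) Curl Omega beta x (perm_index p J).
Proof. by rewrite ffunE. Qed.

Lemma L2t_symCurl beta : H1t beta -> L2t Omega (symCurl Omega beta).
Proof.
move=> h J; have := L2Z oO bO (l.+1`!)%:R^-1 (L2_sum oO bO (index_enum 'S_l.+1)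
  (fun p => L2t_Curl h (perm_index p J))); congr L2.
by apply/funext => x; rewrite symCurlE.
Qed.

Lemma symCurl_lin a beta gamma : H1t beta -> H1t gamma ->
  symCurl Omega (a *: beta + gamma) = a *: symCurl Omega beta + symCurl Omega gamma
  %[ae leb2 in Omega].
Proof.
move=> h1 h2; apply: ae_imp (Curl_lin a h1 h2) => x H /H.
by rewrite /symCurl => ->; rewrite !fctE symt_lin.
Qed.

Lemma symCurl_0 : symCurl Omega (0 : R * R -> tensor R l) = 0 %[ae leb2 in Omega].
Proof. by apply: ae_imp Curl_0 => x H /H; rewrite /symCurl => ->; exact: symt_0. Qed.

Lemma symCurl_symmetric beta : symmetric_ae Omega (symCurl Omega beta).
Proof. by apply: ae_true => x _; exact: symt_symmetric. Qed.

End CurlOperators.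

(** * Piecewise polynomials *)

Section PiecewisePolynomials.
Context {R : realType}.
Local Notation plane := (measurableTypeR R * measurableTypeR R)%type.
Variable Omega : set (R * R).
Hypothesis oO : open Omega.
Hypothesis bO : bounded_set Omega.
Variable TT : set (set (R * R)).
Hypothesis triTT : triangulation Omega TT.

Definition poly_ae (S : set (R * R)) k (u : R * R -> R) :=
  exists c, u = poly2 k c %[ae leb2 in S].

Lemma poly_ae_lin S k a u v : poly_ae S k u -> poly_ae S k v ->
  poly_ae S k (fun x => a * u x + v x).
Proof.
move=> [c hc] [d hd]; exists (fun i j => a * c i j + d i j).
by apply: ae_imp (ae_and hc hd) => x [h1 h2] Sx; rewrite poly2D h1// h2.
Qed.

Lemma poly_ae_0 S k : poly_ae S k (fun=> 0).
Proof.
exists (fun _ _ => 0); apply: ae_true => x _; rewrite /poly2 big1// => i _.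
by rewrite big1// => j _; rewrite !mul0r.
Qed.

Lemma poly_ae_scale S k a u : poly_ae S k u -> poly_ae S k (fun x => a * u x).
Proof.
move=> h; have := poly_ae_lin a h (poly_ae_0 S k); congr poly_ae.
by apply/funext => x; rewrite addr0.
Qed.

Lemma poly_ae_sum S k (I : Type) (s : seq I) (F : I -> R * R -> R) :
  (forall i, poly_ae S k (F i)) -> poly_ae S k (fun x => \sum_(i <- s) F i x).
Proof.
move=> h; elim: s => [|i s ih].
  by have := poly_ae_0 S k; congr poly_ae; apply/funext => x; rewrite big_nil.
have := poly_ae_lin 1 (h i) ih; congr poly_ae.
by apply/funext => x; rewrite big_cons mul1r.
Qed.

(** [wderiv_smooth] identifies the derivative on the open part of the triangle; the edges left out
    are null. *)
Lemma poly_ae_wderiv T k i u : TT T -> Hm Omega 1 u ->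
  poly_ae (T `&` Omega) k.+1 u -> poly_ae (T `&` Omega) k (wderiv Omega [:: i] u).
Proof.
move=> hT hu [c hc]; have [_ /(_ T hT) tri _ _] := triTT.
have [W [oW WT nW]] := triangle_interior tri.
have [h1 h2] := Hm1_wderiv i hu.
have up : u = poly2 k.+1 c %[ae leb2 in W `&` Omega].
  by apply: ae_imp hc => x H [/WT Tx Ox]; exact: H.
have [d dE] := pderiv_poly2 i k c.
have := wderiv_smooth oO bO (openI oW oO) (@subIsetr _ _ _) hu.1 h1 h2 (smooth_poly2 _ _) up.
rewrite dE => H; exists d.
have nW' : {ae leb2, forall x, T x -> W x}.
  by apply: negligibleS nW => x /= /not_implyP[].
by apply: ae_imp (ae_and H nW') => x [Hx hW] [Tx Ox]; apply: Hx; split => //; exact: hW.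
Qed.

Lemma Pk_lin k l a (u v : R * R -> tensor R l) : Pk Omega TT k l u ->
  Pk Omega TT k l v -> Pk Omega TT k l (a *: u + v).
Proof.
move=> [hu pu] [hv pv]; split; first exact: L2t_lin.
move=> T hT J; have := poly_ae_lin a (pu T hT J) (pv T hT J); congr poly_ae.
by apply/funext => x; rewrite fieldE.
Qed.

Lemma Pk_0 k l : Pk Omega TT k l 0.
Proof.
split; first exact: L2t_0.
move=> T hT J; have := poly_ae_0 (T `&` Omega) k; congr poly_ae.
by apply/funext => x; rewrite field0E.
Qed.

Lemma Xh_lin k l a (u v : R * R -> tensor R l) : Xh Omega TT k l u ->
  Xh Omega TT k l v -> Xh Omega TT k l (a *: u + v).
Proof.
by move=> [pu su] [pv sv]; split; [exact: Pk_lin|exact: symmetric_ae_lin].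
Qed.

Lemma Xh_0 k l : Xh Omega TT k l 0.
Proof. by split; [exact: Pk_0|exact: symmetric_ae_0]. Qed.

(** Components of [symCurl] are linear combinations of first weak derivatives, each of which lowers
    the degree by one on every triangle. This is why the degrees of the two discrete spaces differ
    by one. *)
Lemma symCurl_Xh k l (beta : R * R -> tensor R l) : Pk Omega TT k.+1 l beta ->
  H1t Omega beta -> Xh Omega TT k l.+1 (symCurl Omega beta).
Proof.
move=> [_ pb] hb; split; last exact: symCurl_symmetric.
split; first exact: L2t_symCurl.
move=> T hT J.
have pC J' : poly_ae (T `&` Omega) k (fun x => Curl Omega beta x J').
  have hw i := poly_ae_wderiv i hT (hb (init_index J')) (pb T hT (init_index J')).
  have [e|e] := boolP (tnth J' ord_max == ord0).
    have := poly_ae_scale (-1) (hw ord_max); congr poly_ae.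
    by apply/funext => x; rewrite CurlE e mulN1r.
  have := hw ord0; congr poly_ae.
  by apply/funext => x; rewrite CurlE (negbTE e).
have := poly_ae_scale (l.+1`!)%:R^-1 (poly_ae_sum (index_enum 'S_l.+1)
  (fun p => pC (perm_index p J))); congr poly_ae.
by apply/funext => x; rewrite symCurlE.
Qed.

(** * A finite spanning list for piecewise polynomials *)

Section FiniteDimension.
Variables k l : nat.
Variable ts : seq (set (R * R)).
Hypothesis TTE : TT = [set` ts].

(** Each triangle minus the earlier ones, so that a point on a shared edge activates exactly one
    piece. *)
Let E m : set (R * R) := seqDU (nth set0 ts) m.

Let mE m : measurable (E m : set plane).
Proof.
have mn i : measurable (nth set0 ts i : set plane).
  have [hi|hi] := ltnP i (size ts); last by rewrite nth_default.
  apply: triangle_measurable; have [_ h _ _] := triTT; apply: h.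
  by rewrite TTE /=; exact: mem_nth.
by apply: measurableD => //; apply: bigsetU_measurable => i _; exact: mn.
Qed.

Let idx : Type := ('I_(size ts) * (l.-tuple 'I_2 * ('I_k.+1 * 'I_k.+1)))%type.

(** The exponents range over a full square and exceed the total degree [k]; this is harmless, as
    [projection_exists] allows the list to span a larger space. *)
Let e (m : 'I_(size ts)) (J : l.-tuple 'I_2) (i j : 'I_k.+1) :
  R * R -> tensor R l := fun x =>
  [ffun J' => (J == J')%:R * (\1_(E m) x * (x.1 ^+ i * x.2 ^+ j))].

Let basis : seq (R * R -> tensor R l) :=
  codom (fun q : idx => e q.1 q.2.1 q.2.2.1 q.2.2.2).

Let basis_L2t f : f \in basis -> L2t Omega f.
Proof.
move=> /codomP[[m [J [i j]]] ->] J'.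
have cw : continuous (fun x : R * R => x.1 ^+ i * x.2 ^+ j).
  apply: smooth_fun_continuous.
  exact: smooth_mul (smooth_fstX i) (smooth_sndX j).
have := L2Z oO bO (J == J')%:R (L2_indicM oO bO (mE m) cw); congr L2.
by apply/funext => x; rewrite ffunE.
Qed.

Let sum_idx (G : 'I_(size ts) -> l.-tuple 'I_2 -> 'I_k.+1 -> 'I_k.+1 -> R) :
  \sum_(q : idx) G q.1 q.2.1 q.2.2.1 q.2.2.2 =
  \sum_m \sum_J \sum_i \sum_j G m J i j.
Proof.
rewrite -(pair_bigA _ (fun m (q : (l.-tuple 'I_2 * ('I_k.+1 * 'I_k.+1))%type) =>
  G m q.1 q.2.1 q.2.2)) /=; apply: eq_bigr => m _.
rewrite -(pair_bigA _ (fun J (q : ('I_k.+1 * 'I_k.+1)%type) =>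
  G m J q.1 q.2)) /=; apply: eq_bigr => J _.
by rewrite -(pair_bigA _ (fun i j => G m J i j)).
Qed.

Let field_sumE (I : Type) (s : seq I) (a : I -> R) (F : I -> R * R -> tensor R l) x J :
  (\sum_(i <- s) a i *: F i) x J = \sum_(i <- s) a i * F i x J.
Proof.
elim: s => [|i s ih]; first by rewrite !big_nil field0E.
by rewrite !big_cons fieldE ih.
Qed.

Let Pk_span_seq u : Pk Omega TT k l u -> span_mod (ipt Omega (l:=l)) basis u.
Proof.
move=> [hu pu].
have /choice[c hc] (q : ('I_(size ts) * l.-tuple 'I_2)%type) : exists c : nat -> nat -> R,
    (fun x => u x q.2) = poly2 k c %[ae leb2 in nth set0 ts q.1 `&` Omega].
  by apply: pu; rewrite TTE /=; exact: mem_nth.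
(* [poly2] ignores coefficients beyond the degree bound, whereas the sum over the square of
   exponents would count them; they are set to 0. *)
pose a (m : 'I_(size ts)) J (i j : 'I_k.+1) : R :=
  if (i + j <= k)%N then c (m, J) i j else 0.
pose S := \sum_(q : idx) a q.1 q.2.1 q.2.2.1 q.2.2.2 *: e q.1 q.2.1 q.2.2.1 q.2.2.2.
have [DS sS] : L2t Omega S /\ span_mod (ipt Omega (l:=l)) basis S.
  apply: (@span_mod_sum R _ (L2t Omega (l:=l)) (ipt Omega (l:=l))).
  - exact: L2t_lin.
  - exact: L2t_0.
  - exact: iptC.
  - exact: ipt_lin.
  - exact: ipt_ge0.
  - exact: basis_L2t.
  - by move=> q; exact: codom_f.
have uS : u = S %[ae leb2 in Omega].
  apply: ae_imp (ae_all hc) => x H Ox; apply/ffunP => J.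
  rewrite field_sumE (sum_idx (fun m J' i j => a m J' i j * e m J' i j x J)).
  have : (\bigcup_(T in TT) T) x.
    have [_ _ -> _] := triTT; exact: subset_closure.
  move=> [T]; rewrite TTE /= => Tts Tx.
  have : (\bigcup_m E m) x.
    rewrite /E -(seqDU_bigcup_eq (nth set0 ts)); exists (index T ts) => //.
    by rewrite nth_index.
  move=> [m _ Emx].
  have Fmx : nth set0 ts m x by case: Emx.
  have ms : (m < size ts)%N.
    by rewrite ltnNge; apply/negP => hm; move: Fmx; rewrite nth_default.
  have E0 (m' : 'I_(size ts)) : m' != Ordinal ms -> \1_(E m') x = 0 :> R.
    move=> mm; rewrite indicE memNset// => Em'x.
    have := @trivIset_seqDU _ (nth set0 ts) m m' I I.
    have ne : E m `&` E m' !=set0 by exists x.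
    by move=> /(_ ne) mm'; move: mm; rewrite -val_eqE /= mm' eqxx.
  rewrite (bigD1 (Ordinal ms)) //= [X in _ + X]big1 ?addr0; last first.
    move=> m' hm; rewrite big1// => J' _; rewrite big1// => i _; rewrite big1// => j _.
    by rewrite ffunE E0// mul0r !mulr0.
  rewrite (bigD1 J) //= [X in _ + X]big1 ?addr0; last first.
    move=> J' hJ; rewrite big1// => i _; rewrite big1// => j _.
    by rewrite ffunE (negbTE hJ) mul0r mulr0.
  rewrite (H (Ordinal ms, J)) //= /poly2; apply: eq_bigr => i _.
  rewrite [LHS]big_mkcond; apply: eq_bigr => j _.
  rewrite ffunE eqxx indicE mem_set// !mul1r /a; case: ifP => _; last by rewrite mul0r.
  by rewrite mulrA.
have D0 : L2t Omega (u - S) by exact: L2t_sub.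
rewrite (_ : u = 1 *: (u - S) + S); last by rewrite scale1r subrK.
apply: (@span_mod_lin R _ (L2t Omega (l:=l)) (ipt Omega (l:=l))) => //.
- exact: L2t_lin.
- exact: L2t_0.
- exact: iptC.
- exact: ipt_lin.
- exact: ipt_ge0.
apply: span_mod_null.
apply: (ipt_ae0 oO bO D0 D0).
by apply: ae_imp uS => x H /H; rewrite !fctE => ->; rewrite subrr.
Qed.

Lemma Pk_span_exists : exists s : seq (R * R -> tensor R l),
  (forall f, f \in s -> L2t Omega f) /\
  forall u, Pk Omega TT k l u -> span_mod (ipt Omega (l:=l)) s u.
Proof. by exists basis; split; [exact: basis_L2t|exact: Pk_span_seq]. Qed.

End FiniteDimension.

Lemma Pk_span k l : exists s : seq (R * R -> tensor R l),
  (forall f, f \in s -> L2t Omega f) /\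
  forall u, Pk Omega TT k l u -> span_mod (ipt Omega (l:=l)) s u.
Proof.
have [/finite_seqP[ts E] _ _ _] := triTT.
exact: Pk_span_exists E.
Qed.

End PiecewisePolynomials.

(** * The space Y and the error estimate *)

Section SpaceY.
Context {R : realType}.
Variable Omega : set (R * R).
Hypothesis oO : open Omega.
Hypothesis bO : bounded_set Omega.
Variable n : nat.
Implicit Types beta gamma : R * R -> tensor R n.

Lemma frakH_lin a beta gamma : frakH Omega n beta -> frakH Omega n gamma ->
  frakH Omega n (a *: beta + gamma).
Proof.
move=> [h1 s1 m1] [h2 s2 m2]; split.
- exact: (H1t_lin oO bO a h1 h2).
- exact: symmetric_ae_lin.
move=> J; have mE (u : R * R -> R) :
    \int[leb2]_(x in Omega) u x = ip Omega u (cst 1).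
  by apply: eq_Rintegral => x _; rewrite mulr1.
have := ip_lin oO bO a (h1 J).1 (h2 J).1 (L2_cst oO bO 1).
rewrite -!mE m1 m2 mulr0 addr0 => <-; apply: eq_Rintegral => x _.
exact: fieldE.
Qed.

Lemma frakH_0 : frakH Omega n 0.
Proof.
split; [exact: H1t_0|exact: symmetric_ae_0|move=> J].
under eq_Rintegral do rewrite field0E.
by rewrite Rintegral_cst ?mul0r//; exact: measurable_Omega.
Qed.

Lemma Yspace_lin a beta gamma : Yspace Omega n beta -> Yspace Omega n gamma ->
  Yspace Omega n (a *: beta + gamma).
Proof.
move=> [h1 o1] [h2 o2]; split; first exact: frakH_lin.
move=> z Zz; have [[hz _ _] _] := Zz; have [hb _ _] := h1; have [hg _ _] := h2.
have Cz := L2t_Curl oO bO hz; have Cb := L2t_Curl oO bO hb.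
have Cg := L2t_Curl oO bO hg.
rewrite iptC (ipt_ae oO bO (L2t_Curl oO bO (H1t_lin oO bO a hb hg)) _ Cz
  (Curl_lin oO bO a hb hg)); last exact: L2t_lin.
by rewrite (ipt_lin oO bO a Cb Cg Cz) iptC o1// iptC o2// mulr0 addr0.
Qed.

Lemma Yspace_0 : Yspace Omega n 0.
Proof.
split; first exact: frakH_0.
move=> z [[hz _ _] _]; have Cz := L2t_Curl oO bO hz.
rewrite iptC; apply: (ipt_ae0 oO bO _ Cz); last exact: Curl_0.
exact: (L2t_Curl oO bO (H1t_0 oO bO (l := n))).
Qed.

Lemma Yspace_H1t beta : Yspace Omega n beta -> H1t Omega beta.
Proof. by move=> [[]]. Qed.

(* An element of [Y] annihilated by [sym Curl] lies in [Z], to which it is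
   orthogonal. *)
Lemma Yspace_symCurl_eq0 beta : connected Omega -> Omega !=set0 ->
  Yspace Omega n beta -> symCurl Omega beta = cst 0 %[ae leb2 in Omega] ->
  beta = cst 0 %[ae leb2 in Omega].
Proof.
move=> cO neO [fb ob] sb; have [hb _ mb] := fb.
have C0 := ipt_eq0 oO bO (L2t_Curl oO bO hb) (ob _ (conj fb sb)).
apply: ae_field => J.
have w0 i : wderiv Omega [:: i] (fun x => beta x J) = cst 0 %[ae leb2 in Omega].
  (* Appending the other index to [J] selects the component of [Curl] that is, up to sign, the
     derivative in direction [i]. *)
  pose i' : 'I_2 := if i == ord0 then ord_max else ord0.
  pose J' : n.+1.-tuple 'I_2 := [tuple of rcons J i'].
  have JE : init_index J' = J.
    apply: eq_from_tnth => j; rewrite tnth_mktuple !(tnth_nth ord0) /=.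
    by rewrite nth_rcons size_tuple ltn_ord.
  have iE : tnth J' ord_max = i'.
    by rewrite (tnth_nth ord0) /= nth_rcons size_tuple ltnn eqxx.
  apply: ae_imp C0 => x H /H /ffunP/(_ J'); rewrite CurlE JE iE ffunE /i'.
  have [->|i0] := eqVneq i ord0; first by [].
  have -> : i = ord_max by case: i i0 {i' J' JE iE} => -[|[|//]] hi // _; exact: val_inj.
  by rewrite eqxx => /eqP; rewrite oppr_eq0 => /eqP.
have [|K hK] := const_of_connected oO bO (hb J).1 _ cO neO.
  move=> i v tv; have [h1 h2] := Hm1_wderiv i (hb J).
  have := h2 v tv; rewrite /= => ->.
  rewrite (ip_ae oO h1 (L2_cst oO bO 0) (L2_pderivs oO bO [::] tv) (w0 i)).
  by rewrite /ip; under eq_Rintegral do rewrite mul0r;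
    rewrite Rintegral_cst ?mul0r ?mulr0//; exact: measurable_Omega.
have := mb J; rewrite (Rintegral_ae oO (L2_measurable oO (hb J).1)
  (L2_measurable oO (L2_cst oO bO K)) hK).
have mO := measurable_Omega oO.
(* Zero mean reads [K] times the area of [Omega] equals 0. The case of area 0 needs no
   contradiction, since it makes the claim trivially true. *)
rewrite Rintegral_cst// => /eqP; rewrite mulf_eq0 => /orP[/eqP K0|/eqP O0].
  by apply: ae_imp hK => x H /H ->; rewrite K0 ffunE.
have [z Oz] := neO.
have n0 : leb2.-negligible Omega.
  apply/negligibleP => //; have := bounded_leb2 bO oO => fO.
  have fin : leb2 Omega \is a fin_num by rewrite ge0_fin_numE.
  exact: etrans (esym (fineK fin)) (congr1 EFin O0).
by apply: negligibleS n0 => x /= /not_implyP[].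
Qed.

End SpaceY.

(* The order of the problem is m = n.+1; kappa bounds the shape regularity. *)
Theorem theorem5p6 (R : realType) (Omega : set (R * R)) (n k : nat) (kappa : R) :
  domain Omega -> bounded_set Omega -> polygonal Omega ->
  simply_connected Omega -> lipschitz_boundary Omega ->
  exists2 C : R, 0 < C &
  forall (f : R * R -> R) (phi sigma : R * R -> tensor R n.+1)
    (alpha : R * R -> tensor R n) (TT : set (set (R * R))),
    L2 Omega f ->
    Hdivm Omega phi ->
    (fun x => (-1) ^+ n.+1 * divm Omega phi x) = f %[ae leb2 in Omega] ->
    mixed_solution Omega (L2S Omega n.+1) (Yspace Omega n) phi sigma alpha ->
    triangulation Omega TT -> shape_regular kappa TT ->
  exists (sigmah : R * R -> tensor R n.+1) (alphah : R * R -> tensor R n),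
    [/\ mixed_solution Omega (Xh Omega TT k n.+1) (Yh Omega TT k n)
          phi sigmah alphah,
        forall sigma' alpha',
          mixed_solution Omega (Xh Omega TT k n.+1) (Yh Omega TT k n)
            phi sigma' alpha' ->
          sigma' = sigmah %[ae leb2 in Omega] /\
          alpha' = alphah %[ae leb2 in Omega] &
        exists dsigma dalpha : R,
        [/\ is_min [set L2norm Omega (sigma \- tauh) | tauh in Xh Omega TT k n.+1]
              dsigma,
            is_min [set L2norm Omega (symCurl Omega (alpha \- betah))
                   | betah in Yh Omega TT k n] dalpha &
            L2norm Omega (sigma \- sigmah)
              + L2norm Omega (symCurl Omega (alpha \- alphah))
            <= C * (dsigma + dalpha)]].
Proof.
move=> [oO cO neO] bO _ _ _; exists 2 => //.
move=> f phi sigma alpha TT _ [Dphi _] _ [[Ds Ss] Ya e1 e2] tri _.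
pose V : lmodType R := (R * R -> tensor R n.+1 : lmodType R).
pose D : set V := L2t Omega (l:=n.+1); pose B : V -> V -> R := ipt Omega (l:=n.+1).
pose X : set V := Xh Omega TT k n.+1; pose Yk := Yh Omega TT k n.
pose sC := symCurl Omega (l:=n).
have {}Dphi : D phi by exact: Dphi.
have {}Ds : D sigma by exact: Ds.
have Dl : forall a u v, D u -> D v -> D (a *: u + v) by exact: L2t_lin.
have D0 : D 0 by exact: L2t_0.
have Bs : forall u v, B u v = B v u by exact: iptC.
have Bl : forall a u v w, D u -> D v -> D w -> B (a *: u + v) w = a * B u w + B v w.
  exact: ipt_lin.
have Bg : forall u, 0 <= B u u by exact: ipt_ge0.
have Bsub u v w : D u -> D v -> D w -> B (u - v) w = B u w - B v w.
  exact: B_subl.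
have XD : X `<=` D by move=> u [[]].
have Xl a u v : X u -> X v -> X (a *: u + v) by exact: Xh_lin.
have X0 : X 0 by exact: Xh_0.
have Xs u v : X u -> X v -> X (u - v).
  by move=> Xu Xv; rewrite addrC -scaleN1r; exact: Xl.
have Yl a b c : Yk b -> Yk c -> Yk (a *: b + c).
  by move=> [p1 y1] [p2 y2]; split; [exact: Pk_lin|exact: Yspace_lin].
have Y0 : Yk 0 by split; [exact: Pk_0|exact: Yspace_0].
have subY b c : Yspace Omega n b -> Yspace Omega n c -> Yspace Omega n (b - c).
  by move=> Yb Yc; rewrite addrC -scaleN1r; exact: Yspace_lin.
have YkY b : Yk b -> Yspace Omega n b by case.
have sCX b : Yk b -> X (sC b).
  by move=> [pb yb]; apply: symCurl_Xh => //; exact: Yspace_H1t yb.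
have DsC b : Yspace Omega n b -> D (sC b).
  by move=> /Yspace_H1t hb; exact: L2t_symCurl.
have sC_sub b c : Yspace Omega n b -> Yspace Omega n c ->
    sC (b - c) = sC b - sC c %[ae leb2 in Omega].
  move=> /Yspace_H1t hb /Yspace_H1t hc.
  have := symCurl_lin oO bO (-1) hc hb.
  by rewrite !scaleN1r ![- _ + _]addrC.
(* The estimate speaks of [symCurl] of a difference, projections of a difference of [symCurl]; the
   two agree only off a null set, which the norm does not see. *)
have nrm_sub b c : Yspace Omega n b -> Yspace Omega n c ->
    L2norm Omega (sC (b - c)) = seminorm B (sC b - sC c).
  move=> Yb Yc; have h := sC_sub _ _ Yb Yc; have d1 := DsC _ (subY _ _ Yb Yc).
  have d2 := D_sub Dl (DsC _ Yb) (DsC _ Yc).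
  rewrite /L2norm /seminorm (ipt_ae oO bO d1 d2 d1 h) iptC.
  by rewrite (ipt_ae oO bO d1 d2 d2 h).
have [s [sD sP]] := Pk_span oO bO tri k n.+1.
have Xspan u : X u -> span_mod B s u by move=> [/sP].
have projX g : D g -> exists2 p, X p & forall w, X w -> B (g - p) w = 0.
  by move=> Dg; exact: (projection_exists Dl D0 Bs Bl Bg sD XD X0 Xl Xspan Dg).
(* The literal image of [Yk] under [sC] need not be a linear subspace; closing it under almost
   everywhere equality makes it one. *)
pose W : set V := [set w | D w /\ exists2 b, Yk b & w = sC b %[ae leb2 in Omega]].
have WD : W `<=` D by move=> w [].
have W0 : W 0.
  split => //; exists 0 => //; have := @symCurl_0 R Omega oO bO n.
  by apply: ae_imp => x H /H h; exact: esym h.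
have Wl a u v : W u -> W v -> W (a *: u + v).
  move=> [Du [b Yb ub]] [Dv [c Yc vc]]; split; first exact: Dl.
  exists (a *: b + c); first exact: Yl.
  have hb := Yspace_H1t (YkY _ Yb); have hc := Yspace_H1t (YkY _ Yc).
  apply: ae_imp (ae_and (symCurl_lin oO bO a hb hc) (ae_and ub vc)).
  by move=> x [h [h1 h2]] Ox; rewrite /sC h// !fctE h1// h2.
(* Up to a null vector [w] lies in [X], so the list that spans [X] also serves for [W]. *)
have Wspan w : W w -> span_mod B s w.
  move=> [Dw [b Yb wb]]; have Db := DsC _ (YkY _ Yb); have Dd := D_sub Dl Dw Db.
  rewrite (_ : w = 1 *: (w - sC b) + sC b); last by rewrite scale1r subrK.
  apply: (span_mod_lin Dl D0 Bs Bl Bg) => //; last by apply: Xspan; exact: sCX.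
  apply: span_mod_null; apply: (ipt_ae0 oO bO Dd Dd).
  by apply: ae_imp wb => x H /H; rewrite !fctE => ->; rewrite subrr.
have [q Xq hq] := projX phi Dphi.
have [p [Dp [alphah Yah pE]] hp] := projection_exists Dl D0 Bs Bl Bg sD WD W0 Wl Wspan Dphi.
pose sigmah : V := q - sC alphah.
have DSh := DsC _ (YkY _ Yah); have Dq := XD _ Xq.
have Xsh : X sigmah by apply: Xs => //; exact: sCX.
have Dsh := XD _ Xsh; have DS := DsC _ Ya.
have ms : mixed_solution Omega X Yk phi sigmah alphah.
  split => //.
  - move=> tau Xt; have Dt := XD _ Xt; have := hq _ Xt.
    rewrite (Bsub _ _ _ Dphi Dq Dt) => /subr0_eq.
    rewrite -/(B sigmah tau) -/(B tau (sC alphah)) -/(B phi tau) => ->.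
    by rewrite (Bsub _ _ _ Dq DSh Dt) (Bs tau) subrK.
  (* Against [sC b] both [q] and [sC alphah] act like [phi]: the first because [sC b] lies in [X],
     the second because it lies in [W]. Their difference is thus orthogonal to it. *)
  - move=> b Yb; have Db := DsC _ (YkY _ Yb).
    rewrite -/(B sigmah (sC b)) (Bsub _ _ _ Dq DSh Db).
    have := hq _ (sCX _ Yb); rewrite (Bsub _ _ _ Dphi Dq Db) => /subr0_eq <-.
    rewrite /B -(ipt_ae oO bO Dp DSh Db pE) -(Bsub _ _ _ Dphi Dp Db).
    have Wb : W (sC b).
      by split; [exact: Db|exists b; [exact: Yb|apply: ae_true => x _]].
    exact: hp Wb.
exists sigmah, alphah; split => //.
  move=> s' a' [Xs' Ya' m1 m2]; have [_ _ m3 m4] := ms.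
  have Ds' := XD _ Xs'; have Xd := Xs _ _ Xs' Xsh; have Dd := XD _ Xd.
  have Da' := DsC _ (YkY _ Ya').
  (* The difference is an admissible test in both first equations, and the second equations remove
     the coupling terms. *)
  have ds0 : B (s' - sigmah) (s' - sigmah) = 0.
    have E1 := m1 _ Xd; have E2 := m3 _ Xd.
    have z b : Yk b -> B (s' - sigmah) (sC b) = 0.
      move=> Yb; rewrite (Bsub _ _ _ Ds' Dsh (DsC _ (YkY _ Yb))).
      by rewrite /B m2// m4// subrr.
    have z1 := z _ Ya'; have z2 := z _ Yah.
    rewrite (Bsub _ _ _ Ds' Dsh Dd); move: E1 E2.
    rewrite -!/(sC _) -!/(B _ _) z1 z2 !addr0 => -> ->; exact: subrr.
  have s0 := ipt_eq0 oO bO Dd ds0; split.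
    apply: ae_imp s0 => x H /H /= h; apply/eqP; rewrite -subr_eq0; apply/eqP.
    exact: h.
  (* With the first components equal, the first equations are compared on this difference itself, a
     valid test because [sC] maps [Yk] into [X]. *)
  have sc0 : B (sC a' - sC alphah) (sC a' - sC alphah) = 0.
    have Xc := Xs _ _ (sCX _ Ya') (sCX _ Yah); have Dc := XD _ Xc.
    have E1 := m1 _ Xc; have E2 := m3 _ Xc.
    have z : B (s' - sigmah) (sC a' - sC alphah) = 0.
      exact: (ipt_ae0 oO bO Dd Dc s0).
    move: z E1 E2; rewrite (Bsub _ _ _ Ds' Dsh Dc) -!/(sC _) -!/(B _ _).
    rewrite (Bsub _ _ _ Da' DSh Dc) (Bs (sC a')) (Bs (sC alphah)).
    move=> /subr0_eq -> h1 h2; apply/eqP; rewrite subr_eq0; apply/eqP.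
    exact: (addrI _ (etrans h1 (esym h2))).
  have h0 := ipt_eq0 oO bO (D_sub Dl Da' DSh) sc0.
  have Yd := subY _ _ (YkY _ Ya') (YkY _ Yah).
  have : a' - alphah = cst 0 %[ae leb2 in Omega].
    apply: (Yspace_symCurl_eq0 oO bO cO neO Yd).
    apply: ae_imp (ae_and (sC_sub _ _ (YkY _ Ya') (YkY _ Yah)) h0) => x [E1 E2] Ox.
    by rewrite -/(sC _) E1// E2.
  apply: ae_imp => x H /H /= h; apply/eqP; rewrite -subr_eq0; apply/eqP; exact: h.
have [P XP hP] := projX sigma Ds.
have L2X tau : X tau -> L2S Omega n.+1 tau.
  by move=> Xt; split; [exact: XD|case: Xt].
have [_ _ m3 m4] := ms.
(* Both minima are attained: the first at the projection [P] of [sigma], the second at the discrete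
   solution [alphah]. *)
exists (seminorm B (sigma - P)), (seminorm B (sC alpha - sC alphah)); split.
- split; first by exists P.
  move=> _ [tau Xt <-]; rewrite -[L2norm _ _]/(seminorm B (sigma - tau)).
  rewrite (_ : sigma - tau = (sigma - P) + (P - tau)); last by rewrite addrA subrK.
  have Xr := Xs _ _ XP Xt; apply: (seminorm_orthogonal Dl Bs Bl Bg) => //.
  + exact: (D_sub Dl Ds (XD _ XP)).
  + exact: XD.
  + exact: hP.
- split; first by exists alphah => //; exact: nrm_sub (YkY _ Yah).
  move=> _ [b Yb <-]; rewrite [X in _ <= X](nrm_sub _ _ Ya (YkY _ Yb)).
  have Db := DsC _ (YkY _ Yb); have Dr := D_sub Dl DSh Db.
  rewrite (_ : sC alpha - sC b =
    (sC alpha - sC alphah) + (sC alphah - sC b)); last first.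
    by rewrite addrA subrK.
  apply: (seminorm_orthogonal Dl Bs Bl Bg (D_sub Dl DS DSh) Dr).
  have Xr := Xs _ _ (sCX _ Yah) (sCX _ Yb).
  (* [sC c] is admissible in both first equations, and there [sigma] and [sigmah] drop out by the
     second equations. *)
  have z c : Yk c -> B (sC alpha - sC alphah) (sC c) = 0.
    move=> Yc; have Xc := sCX _ Yc; have Dc := XD _ Xc.
    have E1 : B sigma (sC c) + B (sC c) (sC alpha) = B phi (sC c) := e1 _ (L2X _ Xc).
    have E2 : B sigmah (sC c) + B (sC c) (sC alphah) = B phi (sC c) := m3 _ Xc.
    have F1 : B sigma (sC c) = 0 := e2 _ (YkY _ Yc).
    have F2 : B sigmah (sC c) = 0 := m4 _ Yc.
    rewrite F1 add0r in E1; rewrite F2 add0r in E2.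
    by rewrite (Bsub _ _ _ DS DSh Dc) (Bs (sC alpha)) (Bs (sC alphah)) E1 E2 subrr.
  rewrite Bs (Bsub _ _ _ DSh Db (D_sub Dl DS DSh)) !(Bs _ (sC alpha - sC alphah)).
  by rewrite !z// subrr.
- have E tau : X tau -> B sigma tau + B tau (sC alpha) = B sigmah tau + B tau (sC alphah).
    by move=> Xt; exact: etrans (e1 _ (L2X _ Xt)) (esym (m3 _ Xt)).
  (* This bounds the error of [sigmah] by the sum of the two minima. Adding the error of [alphah]
     counts the second minimum twice, and raising the first to the same weight gives the constant
     2. *)
  have := mixed_error Dl Bs Bl Bg XD Xs Ds DS DSh Xsh XP hP E.
  rewrite [X in _ + X <= _](nrm_sub _ _ Ya (YkY _ Yah)).
  rewrite -[L2norm _ _]/(seminorm B (sigma - sigmah)).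
  have := seminorm_ge0 B (sigma - P); lra.
Qed.
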